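(* Assume the setup below, with $t_{\min}$ known, $D\subset B_R$ and $|x|=R$. (i) For every $y\in A_D^{(x)}$ there exists $\epsilon_0>0$ such that $\tilde\phi^{(x)}_{y,\eta,\epsilon}\in\mathrm{Range}(\tilde L_D^{(x)})$ for all $\epsilon\in(0,\epsilon_0)$ and all $\eta\in(t_{\min},t_{\max}]$. (ii) Let $\eta\in(t_{\min},t_{\max}]$. If $y\notin\overline{A_{D,\eta}^{(x)}}$, then $\tilde\phi^{(x)}_{y,\eta,\epsilon}\notin\mathrm{Range}(\tilde L_D^{(x)})$ for all $\epsilon>0$.
   Context: $D\subset\mathbb R^3$ is a bounded Lipschitz domain (open, connected) with $\mathbb R^3\setminus\overline D$ connected, $D\subset B_R=\{|x|<R\}$; $0\le t_{\min}<t_{\max}$; $S\in C([t_{\min},t_{\max}];L^\infty(D))$ real-valued with $S\ge c_0>0$ a.e. on $D\times[t_{\min},t_{\max}]$. Let $0\le k_{\min}<k_{\max}$, $K=(k_{\max}-k_{\min})/2$, $X_D=L^2(D\times(t_{\min},t_{\max}))$. For $|x|=R$, $\tilde L_D^{(x)}:X_D\to L^2(0,K)$ is $(\tilde L_D^{(x)}u)(\tau)=\int_{t_{\min}}^{t_{\max}}\int_D e^{{\rm i}\tau(t+|x-y|)}u(y,t)\,dy\,dt$, $\tau\in[0,K]$. Test function: for $y\in\mathbb R^3$, $\epsilon>0$, $\eta>t_{\min}$, $\tilde\phi^{(x)}_{y,\eta,\epsilon}(k)=\frac{1}{(\eta-t_{\min})|B_\epsilon(y)|}\int_{t_{\min}}^{\eta}\int_{B_\epsilon(y)}e^{{\rm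 i}k(t+|x-z|)}\,dz\,dt$, $k\in[0,K]$ ($B_\epsilon(y)$ open ball, $|B_\epsilon(y)|$ its volume). Annuli: $A_D^{(x)}=\{y\in\mathbb R^3:\inf_{z\in D}|x-z|<|x-y|<\sup_{z\in D}|x-z|\}$ and $A_{D,\eta}^{(x)}=\{y\in\mathbb R^3:\inf_{z\in D}|x-z|<|x-y|<\sup_{z\in D}|x-z|+t_{\max}-\eta\}$. *)

(* Defs.v *)
From HB Require Import structures.
From mathcomp Require Import all_boot all_order all_algebra.
From mathcomp Require Import all_classical all_reals all_analysis.
Set Implicit Arguments. Unset Strict Implicit. Unset Printing Implicit Defensive.
Import Order.TTheory GRing.Theory Num.Theory.
Import numFieldNormedType.Exports.
Local Open Scope classical_set_scope.
Local Open Scope ring_scope.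

Section Setup.
Variable R : realType.

(* Points of R^3 are triples ((a, b), c); topology/measurable structure are the
   product ones (product topology = Euclidean topology). *)
Definition pt := ((R * R) * R)%type.

Definition pt0 : pt := ((0, 0), 0).

Definition dist3 (p q : pt) : R :=
  Num.sqrt ((p.1.1 - q.1.1) ^+ 2 + (p.1.2 - q.1.2) ^+ 2 + (p.2 - q.2) ^+ 2).

Definition ball3 (y : pt) (e : R) : set pt := [set z | dist3 y z < e].

Definition leb3 : set pt -> \bar R :=
  ((@lebesgue_measure R \x @lebesgue_measure R) \x @lebesgue_measure R)%E.
Definition lebST : set (pt * R) -> \bar R :=
  (leb3 \x @lebesgue_measure R)%E.

Definition RintL d (T : measurableType d) (mu : set T -> \bar R)
  (A : set T) (f : T -> R) : R := fine (\int[mu]_(x in A) (f x)%:E)%E.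

Definition to_row (p : pt) : 'rV[R]_3 :=
  \row_(i < 3) (if (i == 0 :> nat) then p.1.1
                else if (i == 1 :> nat) then p.1.2 else p.2).
Definition coord3 (v : 'rV[R]_3) (k : nat) : R := v ord0 (inord k).
Definition mat_act (Q : 'M[R]_3) (p : pt) : pt :=
  let w := to_row p *m Q^T in ((coord3 w 0, coord3 w 1), coord3 w 2).
Definition orthogonal3 (Q : 'M[R]_3) : Prop := Q *m Q^T = 1%:M.

Definition lipschitz2 (g : R -> R -> R) : Prop :=
  exists L : R, forall a b a' b' : R,
    `|g a b - g a' b'| <= L * Num.sqrt ((a - a') ^+ 2 + (b - b') ^+ 2).

Definition pt_sub (p q : pt) : pt :=
  ((p.1.1 - q.1.1, p.1.2 - q.1.2), p.2 - q.2).

Definition lipschitz_boundary (D : set pt) : Prop :=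
  forall p : pt, closure D p -> ~ D p ->
    exists (W : set pt) (Q : 'M[R]_3) (g : R -> R -> R),
      [/\ open W, W p, orthogonal3 Q, lipschitz2 g &
       forall z : pt, W z ->
         (D z <-> let w := mat_act Q (pt_sub z p) in w.2 < g w.1.1 w.1.2)].

Definition bounded3 (D : set pt) : Prop :=
  exists M : R, forall z, D z -> dist3 pt0 z < M.

Definition bounded_lipschitz_domain (D : set pt) : Prop :=
  [/\ open D, connected D, D !=set0, bounded3 D & lipschitz_boundary D].

(* X_D = L^2(D x (tmin, tmax)), complex valued: u = ur + i ui *)
Definition in_L2 (A : set (pt * R)) (ur ui : pt * R -> R) : Prop :=
  [/\ measurable_fun A ur, measurable_fun A ui &
      (\int[lebST]_(yt in A) ((ur yt) ^+ 2 + (ui yt) ^+ 2)%:E < +oo)%E].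

Definition STdom (D : set pt) (tmin tmax : R) : set (pt * R) :=
  D `*` `]tmin, tmax[.

Definition phase (x : pt) (tau : R) (yt : pt * R) : R :=
  tau * (yt.2 + dist3 x yt.1).
Definition LD_re (D : set pt) (tmin tmax : R) (x : pt) (ur ui : pt * R -> R)
  (tau : R) : R :=
  RintL lebST (STdom D tmin tmax)
    (fun yt => cos (phase x tau yt) * ur yt - sin (phase x tau yt) * ui yt).
Definition LD_im (D : set pt) (tmin tmax : R) (x : pt) (ur ui : pt * R -> R)
  (tau : R) : R :=
  RintL lebST (STdom D tmin tmax)
    (fun yt => sin (phase x tau yt) * ur yt + cos (phase x tau yt) * ui yt).

Definition phi_coef (tmin : R) (y : pt) (eta eps : R) : R :=
  ((eta - tmin) * fine (leb3 (ball3 y eps)))^-1.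
Definition phi_re (tmin : R) (x y : pt) (eta eps k : R) : R :=
  phi_coef tmin y eta eps *
  RintL lebST (ball3 y eps `*` `]tmin, eta[) (fun zt => cos (phase x k zt)).
Definition phi_im (tmin : R) (x y : pt) (eta eps k : R) : R :=
  phi_coef tmin y eta eps *
  RintL lebST (ball3 y eps `*` `]tmin, eta[) (fun zt => sin (phase x k zt)).

(* f in Range(L_D^{(x)}) : L^2(D x (tmin,tmax)) -> L^2(0,K), where
   f = fre + i fim; equality in L^2(0,K) means a.e. on (0,K). *)
Definition in_range_LD (D : set pt) (tmin tmax : R) (x : pt) (K : R)
  (fre fim : R -> R) : Prop :=
  exists ur ui : pt * R -> R,
    in_L2 (STdom D tmin tmax) ur ui /\
    {ae (@lebesgue_measure R), forall tau : R, `]0, K[%classic tau ->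
       LD_re D tmin tmax x ur ui tau = fre tau /\
       LD_im D tmin tmax x ur ui tau = fim tau}.

Definition dist_set (x : pt) (D : set pt) : set R := [set dist3 x z | z in D].
Definition annulus_D (D : set pt) (x : pt) : set pt :=
  [set y | inf (dist_set x D) < dist3 x y < sup (dist_set x D)].
Definition annulus_D_eta (D : set pt) (tmax eta : R) (x : pt) : set pt :=
  [set y | inf (dist_set x D) < dist3 x y < sup (dist_set x D) + tmax - eta].

End Setup.

(* Main.v *)
Require Import Defs.
From HB Require Import structures.
From mathcomp Require Import all_boot all_order all_algebra.
From mathcomp Require Import all_classical all_reals all_analysis.
From mathcomp Require Import ring lra.
From mathcomp Require Import measurable_realfun.
Import Order.TTheory GRing.Theory Num.Theory.
Import numFieldNormedType.Exports.
Local Open Scope classical_set_scope.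
Local Open Scope ring_scope.

Set Implicit Arguments. Unset Strict Implicit. Unset Printing Implicit Defensive.

(* Write rho z = |x - z|; the operator sees a density u on D x (tmin, tmax) only through
   the image of u dy dt under (y, t) |-> t + rho y.
   (i) Near r = rho y, with y in the annulus, the image of Lebesgue measure under rho has
   a density that is bounded above on all of R^3 (by scaling, the shell s < rho <= t has
   volume V (t^3 - s^3)) and bounded below on D (D is connected, so it contains a point at
   distance r and a neighbourhood of it).  Hence for small eps the image of Lebesgue
   measure on the ball is w times its image from D with w bounded (Radon-Nikodym), and
   u = const * w(rho y) 1_{t < eta} is a preimage of the test function.
   (ii) If the test function were the image of u, differentiating the identity under the
   integral sign and letting tau tend to 0 shows that all moments of (t + rho) against u
   and against the test density agree.  Outside the closed annulus the positive test
   density charges values of t + rho strictly beyond one end of the interval of values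
   taken on D x (tmin, tmax), so for a suitable c the even moments of t + rho - c against
   it grow strictly faster than those against u. *)

(** * Lebesgue measure on [R^3] and on space-time as sigma-finite measures *)

Lemma sigma_finite_prod {d1 d2} {T1 : measurableType d1} {T2 : measurableType d2}
    {R : realType} (m1 : {sigma_finite_measure set T1 -> \bar R})
    (m2 : {sigma_finite_measure set T2 -> \bar R}) :
  sigma_finite setT (m1 \x m2)%E.
Proof.
have /sigma_finiteP[F [TF ndF Foo]] := sigma_finiteT m1.
have /sigma_finiteP[G [TG ndG Goo]] := sigma_finiteT m2.
exists (fun n => F n `*` G n).
  rewrite -setXTT TF TG predeqE => -[x y]; split.
    move=> [/= [n _ Fnx] [k _ Gky]]; exists (maxn n k) => //; split.
    - by move: x Fnx; exact/subsetPset/ndF/leq_maxl.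
    - by move: y Gky; exact/subsetPset/ndG/leq_maxr.
  by move=> [n _ []/= ? ?]; split; exists n.
move=> k; have [? ?] := Foo k; have [? ?] := Goo k.
split; first exact: measurableX.
by rewrite product_measure1E// lte_mul_pinfty// ge0_fin_numE.
Qed.

(* [leb3] mixes the two (convertible) sigma-algebras that the library puts on the
   real line; [lam], [lam2] and [lam3] live on the canonical one. *)
Definition lam {R : realType} : set R -> \bar R := @lebesgue_measure R.
HB.instance Definition _ (R : realType) := isMeasure.Build _ _ _ (@lam R)
  (measure0 (@lebesgue_measure R)) (measure_ge0 (@lebesgue_measure R))
  (@measure_semi_sigma_additive _ _ _ (@lebesgue_measure R)).
HB.instance Definition _ (R : realType) := Measure_isSigmaFinite.Build _ _ _ (@lam R)
  (sigma_finiteT (@lebesgue_measure R)).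

Definition lam2 {R : realType} : set (R * R) -> \bar R := (@lam R \x @lam R)%E.
HB.instance Definition _ (R : realType) := Measure.on (@lam2 R).
HB.instance Definition _ (R : realType) := Measure_isSigmaFinite.Build _ _ _ (@lam2 R)
  (sigma_finite_prod (@lam R) (@lam R)).

Definition lam3 {R : realType} : set (R * R * R) -> \bar R := (@lam2 R \x @lam R)%E.
HB.instance Definition _ (R : realType) := Measure.on (@lam3 R).
HB.instance Definition _ (R : realType) := Measure_isSigmaFinite.Build _ _ _ (@lam3 R)
  (sigma_finite_prod (@lam2 R) (@lam R)).

Definition leb2 {R : realType} : set (R * R) -> \bar R :=
  (@lebesgue_measure R \x @lebesgue_measure R)%E.
HB.instance Definition _ (R : realType) := isMeasure.Build _ _ _ (@leb2 R)
  (measure0 (@lebesgue_measure R \x @lebesgue_measure R)%E)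
  (measure_ge0 (@lebesgue_measure R \x @lebesgue_measure R)%E)
  (@measure_semi_sigma_additive _ _ _ (@lebesgue_measure R \x @lebesgue_measure R)%E).

Lemma lam2E {R : realType} (E : set (R * R)) : measurable E -> lam2 E = leb2 E.
Proof.
apply: (@product_measure_unique _ _ _ _ _ (@lam R) (@lam R) (@leb2 R)) => A B mA mB.
by rewrite /leb2 [LHS]product_measure1E.
Qed.

HB.instance Definition _ (R : realType) := isMeasure.Build _ _ _ (@leb3 R)
  (measure0 ((@lebesgue_measure R \x @lebesgue_measure R) \x @lebesgue_measure R)%E)
  (measure_ge0 ((@lebesgue_measure R \x @lebesgue_measure R) \x @lebesgue_measure R)%E)
  (@measure_semi_sigma_additive _ _ _
    ((@lebesgue_measure R \x @lebesgue_measure R) \x @lebesgue_measure R)%E).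

(** Both measures agree on products [A x B], which determines a product of sigma-finite measures;
    [lam2E] identifies the planar factor in the same way. *)
Lemma leb3E {R : realType} (E : set (pt R)) : measurable E -> leb3 E = lam3 E.
Proof.
move=> mE; apply/esym.
apply: (@product_measure_unique _ _ _ _ _ (@lam2 R) (@lam R) (@leb3 R)) => // A B mA mB.
transitivity (leb2 A * lam B)%E; first exact: product_measure1E.
by rewrite -lam2E.
Qed.

Lemma leb3_box {R : realType} (A B C : set R) : measurable A -> measurable B ->
  measurable C -> leb3 (A `*` B `*` C) = (lam A * lam B * lam C)%E.
Proof.
move=> mA mB mC; rewrite leb3E; last by do 2 apply: measurableX => //.
rewrite [LHS]product_measure1E//; last exact: measurableX.
by congr (_ * _)%E; exact: product_measure1E.
Qed.

Lemma leb3_sigma_finite {R : realType} : sigma_finite setT (@leb3 R).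
Proof.
have [F FT F_] := sigma_finiteT (@lam3 R).
by exists F => // k; have [mF Foo] := F_ k; split=> //; rewrite leb3E.
Qed.

HB.instance Definition _ (R : realType) := Measure_isSigmaFinite.Build _ _ _ (@leb3 R)
  (@leb3_sigma_finite R).

Lemma lebSTE {R : realType} : @lebST R = (@leb3 R \x @lam R)%E.
Proof. by []. Qed.

HB.instance Definition _ (R : realType) := isMeasure.Build _ _ _ (@lebST R)
  (measure0 (@leb3 R \x @lam R)%E) (measure_ge0 (@leb3 R \x @lam R)%E)
  (@measure_semi_sigma_additive _ _ _ (@leb3 R \x @lam R)%E).
HB.instance Definition _ (R : realType) := Measure_isSigmaFinite.Build _ _ _ (@lebST R)
  (sigma_finite_prod (@leb3 R) (@lam R)).

Lemma RintLE {R : realType} d (T : measurableType d) (mu : {measure set T -> \bar R}) A f :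
  RintL mu A f = \int[mu]_(x in A) f x.
Proof. by []. Qed.

Lemma continuous_pair {T U V : topologicalType} (f : T -> U) (g : T -> V) :
  continuous f -> continuous g -> continuous (fun t => (f t, g t)).
Proof.
by move=> cf cg t; apply: (cvg_pair (G := nbhs (f t)) (H := nbhs (g t))); [exact: cf|exact: cg].
Qed.

(** * Cubes, balls and the distance function in [R^3] *)

Section geometry.
Variable R : realType.
Implicit Types (x y z : pt R) (U : set (pt R)) (e t : R).

(** This is the ball of the product (maximum) metric, hence a basic neighbourhood with an explicit
    volume. *)
Definition box3 y e : set (pt R) := ball y.1.1 e `*` ball y.1.2 e `*` ball y.2 e.

Lemma measurable_box3 y e : measurable (box3 y e).
Proof.
by apply: measurableX; [apply: measurableX|]; exact: measurable_ball.
Qed.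

Lemma leb3_box3 y e : 0 <= e -> leb3 (box3 y e) = ((e *+ 2) ^+ 3)%:E.
Proof.
move=> e0; rewrite leb3_box; [|exact: measurable_ball..].
rewrite [X in (X * _ * _)%E](lebesgue_measure_ball _ e0).
rewrite [X in (_ * X * _)%E](lebesgue_measure_ball _ e0).
rewrite [X in (_ * X)%E](lebesgue_measure_ball _ e0).
by rewrite -!EFinM !exprS expr0 mulr1 mulrA.
Qed.

Lemma nbhs_box3 y U : nbhs y U -> exists2 e, 0 < e & box3 y e `<=` U.
Proof.
by move=> /nbhs_ballP[e e0 yU]; exists e.
Qed.

(** An open set is the countable union of the cubes with rational centre and radius [1 / (n + 1)]
    that it contains. *)
Lemma open_measurable3 U : open U -> measurable U.
Proof.
move=> oU.
pose q3 (q : rat * rat * rat) : pt R := (ratr q.1.1, ratr q.1.2, ratr q.2).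
pose F (i : rat * rat * rat * nat) : set (pt R) :=
  if pselect (box3 (q3 i.1) i.2.+1%:R^-1 `<=` U) then box3 (q3 i.1) i.2.+1%:R^-1
  else set0.
suff -> : U = \bigcup_i F i.
  apply: countable_bigcupT_measurable; first exact: countableP.
  by move=> i; rewrite /F; case: pselect => ? /=; [exact: measurable_box3|exact: measurable0].
apply/seteqP; split=> [x Ux|x [i _]]; last by rewrite /F; case: pselect => [sub|?] /= xi;
  [exact: sub|case: xi].
have [e e0 xU] := nbhs_box3 (open_nbhs_nbhs (conj oU Ux)).
(* With [1 / (n + 1) < e / 2], a cube of this radius that contains [x] lies in [box3 x e] by the
   triangle inequality. *)
pose n := Num.truncn (2 / e).
have ne : n.+1%:R^-1 < e / 2.
  by rewrite -[ltRHS]invrK invf_div ltf_pV2 ?posrE ?divr_gt0// truncnS_gt.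
have n0 : 0 < n.+1%:R^-1 :> R by rewrite invr_gt0.
have rat_near (a : R) : exists q : rat, `|ratr q - a| < n.+1%:R^-1.
  have [|q] := @rat_in_itvoo R (a - n.+1%:R^-1) (a + n.+1%:R^-1).
    by rewrite ltrBlDr -addrA ltrDl addr_gt0.
  by rewrite in_itv/= => /andP[h1 h2]; exists q; rewrite ltr_norml ltrBlDl ltrBrDl h1.
have [q1 h1] := rat_near x.1.1.
have [q2 h2] := rat_near x.1.2.
have [q3' h3] := rat_near x.2.
exists ((q1, q2, q3'), n) => //; rewrite /F/=; case: pselect => [?|nsub] /=.
  by split => /=; [split|] => /=; rewrite /ball/=.
case: nsub => z [[k1 k2] k3]; apply: xU.
move: h1 h2 h3 k1 k2 k3; rewrite /q3 /ball/=.
have tri (q a b : R) : `|q - a| < n.+1%:R^-1 -> `|q - b| < n.+1%:R^-1 -> `|a - b| < e.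
  move=> h k; rewrite -(subrK q a) -addrA (le_lt_trans (ler_normD _ _))//.
  by rewrite distrC (splitr e) ltrD// (lt_trans _ ne).
by move=> h1 h2 h3 k1 k2 k3; split => /=; [split|]; rewrite /ball/=; apply: tri; eassumption.
Qed.

Lemma leb3_nbhs_gt0 y U : measurable U -> nbhs y U -> (0 < leb3 U)%E.
Proof.
move=> mU /nbhs_box3[e e0 yU].
apply: (@lt_le_trans _ _ (leb3 (box3 y e))).
  by rewrite leb3_box3 ?ltW// lte_fin exprn_gt0// mulrn_wgt0.
by apply: le_measure; rewrite ?inE//; exact: measurable_box3.
Qed.

Lemma continuous_dist3 x : continuous (dist3 x).
Proof.
move=> y; apply: (continuous_comp (f := fun z => (x.1.1 - z.1.1) ^+ 2 +
  (x.1.2 - z.1.2) ^+ 2 + (x.2 - z.2) ^+ 2)); last exact: sqrt_continuous.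
have c1 : {for y, continuous (fun z : pt R => z.1.1)}.
  by apply: continuous_comp; [exact: cvg_fst|exact: cvg_fst].
have c2 : {for y, continuous (fun z : pt R => z.1.2)}.
  by apply: continuous_comp; [exact: cvg_fst|exact: cvg_snd].
have c3 : {for y, continuous (fun z : pt R => z.2)} by exact: cvg_snd.
have sq (a : R) (f : pt R -> R) : {for y, continuous f} ->
    {for y, continuous (fun z => (a - f z) ^+ 2)}.
  move=> cf; apply: (@continuous_comp _ _ _ (fun z => a - f z) (fun t => t ^+ 2));
    last exact: exprn_continuous.
  by apply: cvgB => //; exact: cvg_cst.
by apply: cvgD; [apply: cvgD|]; apply: sq.
Qed.

Lemma measurable_dist3 x : measurable_fun setT (dist3 x).
Proof.
apply: (measurability _ (RGenOpens.measurableE R)) => _ [_ [a [b ->]] <-].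
rewrite setTI; apply: open_measurable3.
by apply: open_comp => // z _; exact: continuous_dist3.
Qed.

Lemma dist3_ge0 x y : 0 <= dist3 x y.
Proof. exact: sqrtr_ge0. Qed.

Lemma dist3_coord_le x y : [/\ `|x.1.1 - y.1.1| <= dist3 x y,
  `|x.1.2 - y.1.2| <= dist3 x y & `|x.2 - y.2| <= dist3 x y].
Proof.
have H (a s : R) : a ^+ 2 <= s -> `|a| <= Num.sqrt s.
  by move=> as_; rewrite -sqrtr_sqr ler_wsqrtr.
have := sqr_ge0 (x.1.1 - y.1.1); have := sqr_ge0 (x.1.2 - y.1.2).
by have := sqr_ge0 (x.2 - y.2); split; apply: H; lra.
Qed.

Lemma open_ball3 y e : open (ball3 y e).
Proof.
rewrite (_ : ball3 y e = dist3 y @^-1` [set t | t < e])//.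
by apply: open_comp; [move=> z _; exact: continuous_dist3|exact: open_lt].
Qed.

Lemma ball3_sub_box3 y e : ball3 y e `<=` box3 y e.
Proof.
by move=> z /= yz; have [h1 h2 h3] := dist3_coord_le y z; split => /=;
  [split|]; rewrite /ball/=; apply: le_lt_trans yz.
Qed.

Lemma leb3_ball3_lty y e : (leb3 (ball3 y e) < +oo)%E.
Proof.
have [e0|e0] := leP 0 e; last first.
  rewrite (_ : ball3 y e = set0) ?measure0//.
  rewrite -subset0 => z; rewrite /ball3/= => /(le_lt_trans (dist3_ge0 _ _)).
  by rewrite ltNge (ltW e0).
have mB := open_measurable3 (@open_ball3 y e).
apply: (@le_lt_trans _ _ (leb3 (box3 y e))); last by rewrite leb3_box3// ltry.
apply: le_measure; rewrite ?inE//; first exact: measurable_box3.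
exact: (@ball3_sub_box3 y e).
Qed.

Lemma dist3xx y : dist3 y y = 0.
Proof. by rewrite /dist3 !subrr expr0n/= !addr0 sqrtr0. Qed.

Lemma nbhs_ball3 y e : 0 < e -> nbhs y (ball3 y e).
Proof.
by move=> e0; apply: open_nbhs_nbhs; split; [exact: open_ball3|rewrite /ball3/= dist3xx].
Qed.

Lemma bounded3_leb3_lty (D : set (pt R)) : measurable D -> bounded3 D ->
  (leb3 D < +oo)%E.
Proof.
move=> mD [M DM]; apply: le_lt_trans (leb3_ball3_lty (pt0 R) M).
by apply: le_measure; rewrite ?inE//; exact: open_measurable3 (@open_ball3 _ _).
Qed.

(* The ray from [x] through [y], parametrised by distance to [x]; when [y = x] any
   direction does. *)
Lemma dist3_ray x y : exists g : R -> pt R,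
  [/\ continuous g, g (dist3 x y) = y & forall s, 0 <= s -> dist3 x (g s) = s].
Proof.
have [v [yE v1]] : exists v : pt R, y = (x.1.1 + dist3 x y * v.1.1,
    x.1.2 + dist3 x y * v.1.2, x.2 + dist3 x y * v.2) /\
    v.1.1 ^+ 2 + v.1.2 ^+ 2 + v.2 ^+ 2 = 1.
  have [d0|d0] := eqVneq (dist3 x y) 0.
    exists (1, 0, 0); split => /=; last by rewrite expr1n expr0n/= !addr0.
    have [] := dist3_coord_le x y; rewrite d0 !normr_le0 !subr_eq0.
    move=> /eqP-> /eqP-> /eqP->; rewrite !mul0r !addr0.
    by case: y {d0} => [[]].
  exists (((y.1.1 - x.1.1) / dist3 x y, (y.1.2 - x.1.2) / dist3 x y),
    (y.2 - x.2) / dist3 x y); split => /=.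
    rewrite !(mulrC (dist3 x y)) !divfK// !(addrC x.1.1) !(addrC x.1.2) !(addrC x.2) !subrK.
    by case: y {d0} => [[]].
  rewrite !expr_div_n -!mulrDl.
  have -> : dist3 x y ^+ 2 = (y.1.1 - x.1.1) ^+ 2 + (y.1.2 - x.1.2) ^+ 2 + (y.2 - x.2) ^+ 2.
    rewrite sqr_sqrtr; first by ring.
    by rewrite !addr_ge0 ?sqr_ge0.
  rewrite divff//; apply: contra d0.
  rewrite /dist3 => /eqP h.
  rewrite (_ : _ + _ = (y.1.1 - x.1.1) ^+ 2 + (y.1.2 - x.1.2) ^+ 2 + (y.2 - x.2) ^+ 2); last ring.
  by rewrite h sqrtr0.
exists (fun s => (x.1.1 + s * v.1.1, x.1.2 + s * v.1.2, x.2 + s * v.2)); split.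
- have aff (a b : R) : continuous (fun s : R => a + s * b).
    by move=> s; apply: cvgD; [exact: cvg_cst|apply: cvgMr_tmp; exact: cvg_id].
  by do 2 ?apply: continuous_pair; exact: aff.
- by rewrite -yE.
- move=> s s0; rewrite /dist3/=.
  rewrite (_ : _ + _ = s ^+ 2 * (v.1.1 ^+ 2 + v.1.2 ^+ 2 + v.2 ^+ 2)); last ring.
  by rewrite v1 mulr1 sqrtr_sqr ger0_norm.
Qed.

End geometry.

(** * Continuous functions that vanish on an interval *)

Section zero_sets.
Variable R : realType.
Implicit Types (h : R -> R) (a b : R).

(** A nonzero value persists on a ball inside the interval, and a ball has positive measure. *)
Lemma continuous_ae_eq0 h a b : continuous h ->
  {ae (@lebesgue_measure R), forall t, `]a, b[%classic t -> h t = 0} ->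
  forall t, a < t < b -> h t = 0.
Proof.
move=> ch [N [mN N0 hN]] t tab; apply/eqP; apply: contraT => ht.
have [e /= e0 te] : nbhs_ball t [set s | h s != 0 /\ a < s < b].
  apply/nbhs_ballP; apply: filterI.
  - apply: (ch t [set u | u != 0]); apply: open_nbhs_nbhs; split; [exact: open_neq|exact: ht].
  - have := near_in_itvoo (_ : t \in `]a, b[); rewrite in_itv/= => /(_ tab).
    by apply: filterS => s; rewrite in_itv.
have : (@lebesgue_measure R (ball t e) <= 0)%E.
  rewrite -[leRHS]N0; apply: le_measure; rewrite ?inE//; first exact: measurable_ball.
  move=> s /te [hs sab]; apply: hN => /= hs0.
  by move: hs; rewrite hs0 ?eqxx//= in_itv.
by rewrite [leLHS](lebesgue_measure_ball _ (ltW e0)) leNgt lte_fin mulrn_wgt0.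
Qed.

(** This reaches the endpoint, as is needed to evaluate at [tau = 0] an identity known for [tau] in
    []0, K[]. *)
Lemma continuous_eq0_left h a b : continuous h -> a < b ->
  (forall t, a < t < b -> h t = 0) -> h a = 0.
Proof.
move=> ch ab h0; apply/eqP; apply: contraT => ha.
have [e /= e0 ae] : nbhs_ball a [set s | h s != 0].
  apply/nbhs_ballP; apply: (ch a [set u | u != 0]); apply: open_nbhs_nbhs; split; [exact: open_neq|exact: ha].
pose s := a + Num.min e (b - a) / 2.
have m0 : 0 < Num.min e (b - a) by rewrite lt_min e0 subr_gt0.
have me : Num.min e (b - a) <= e by rewrite ge_min lexx.
have mb : Num.min e (b - a) <= b - a by rewrite ge_min lexx orbT.
have : h s != 0.
  by apply: ae; rewrite /ball/= /s opprD addNKr normrN gtr0_norm; lra.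
by rewrite h0 ?eqxx// /s; apply/andP; split; lra.
Qed.

End zero_sets.

(** * From an identity of oscillatory integrals to the vanishing of all moments *)

Section moments.
Context d (T : measurableType d) (R : realType) (mu : {measure set T -> \bar R}).
Variables (B : set T) (mB : measurable B) (S : T -> R) (mS : measurable_fun B S).
Variables (M : R) (M0 : 0 <= M) (SM : forall t, B t -> `|S t| <= M).
Implicit Types (f g : T -> R) (n : nat) (tau : R).

(** This is the real part of [S^n exp(i tau S) (f + i g)]. Passing to the pair [(- g, f)] multiplies
    by [i], so the same formula also gives minus the imaginary part, and differentiation in [tau]
    raises [n] and rotates the pair. *)
Definition oscillation n f g tau t :=
  S t ^+ n * (cos (tau * S t) * f t - sin (tau * S t) * g t).

Definition oscillatory_moment n f g tau := \int[mu]_(t in B) oscillation n f g tau t.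

(** The majorant is free of [tau], as differentiation under the integral sign requires. *)
Lemma oscillation_le n f g tau t : B t ->
  `|oscillation n f g tau t| <= M ^+ n * (`|f t| + `|g t|).
Proof.
move=> Bt; rewrite normrM normrX ler_pM ?exprn_ge0 ?lerXn2r ?nnegrE ?SM//.
have trig_le (c w : R) : `|c| <= 1 -> `|c * w| <= `|w|.
  by move=> c1; rewrite normrM ler_piMl.
rewrite (le_trans (ler_normB _ _))// lerD// trig_le//.
  by rewrite ler_norml cos_geN1 cos_le1.
by rewrite ler_norml sin_geN1 sin_le1.
Qed.

Lemma integrable_weight n f g : mu.-integrable B (EFin \o f) ->
  mu.-integrable B (EFin \o g) ->
  mu.-integrable B (EFin \o (fun t => M ^+ n * (`|f t| + `|g t|))).
Proof.
move=> intf intg; rewrite /comp; under eq_fun do rewrite EFinM EFinD.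
apply: integrableZl => //; apply: integrableD => //.
  exact: (integrable_norm intf).
exact: (integrable_norm intg).
Qed.

Lemma measurable_oscillation n f g tau : mu.-integrable B (EFin \o f) ->
  mu.-integrable B (EFin \o g) -> measurable_fun B (oscillation n f g tau).
Proof.
move=> /integrableP[/measurable_EFinP mf _] /integrableP[/measurable_EFinP mg _].
apply: measurable_funM; first exact: measurable_funX.
apply: measurable_funB; apply: measurable_funM => //.
  apply: (measurableT_comp (f := cos)).
    by apply: continuous_measurable_fun; exact: continuous_cos.
  by apply: measurable_funM.
apply: (measurableT_comp (f := sin)).
  by apply: continuous_measurable_fun; exact: continuous_sin.
by apply: measurable_funM.
Qed.

Lemma integrable_oscillation n f g tau : mu.-integrable B (EFin \o f) ->
  mu.-integrable B (EFin \o g) ->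
  mu.-integrable B (EFin \o oscillation n f g tau).
Proof.
move=> intf intg; apply: (le_integrable mB _ _ (integrable_weight n intf intg)).
  by apply/measurable_EFinP; exact: measurable_oscillation.
move=> t Bt /=; rewrite lee_fin (le_trans (oscillation_le _ _ _ _ Bt))//.
exact: ler_norm.
Qed.

Lemma is_derive_oscillation n f g t tau :
  is_derive tau 1 ((oscillation n f g)^~ t) (oscillation n.+1 (\- g) f tau t).
Proof.
have lin : is_derive tau 1 (fun u : R => u * S t) (S t).
  have -> : (fun u : R => u * S t) = (S t \*: (@id R)).
    by apply/funext => u /=; rewrite mulrC.
  by apply: is_derive_eq; rewrite /GRing.scale/= mulr1.
have dcos := @is_derive1_comp _ cos (fun u : R => u * S t) tau _ _ (is_derive_cos _) lin.
have dsin := @is_derive1_comp _ sin (fun u : R => u * S t) tau _ _ (is_derive_sin _) lin.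
rewrite (_ : _^~ t = (S t ^+ n) \*: ((f t \*: (cos \o (fun u : R => u * S t))) -
    (g t \*: (sin \o (fun u : R => u * S t))))); last first.
  by apply/funext => u; rewrite /oscillation !fctE/= /GRing.scale/= (mulrC (f t)) (mulrC (g t)).
apply: is_derive_eq; rewrite /oscillation /GRing.scale/= exprS; ring.
Qed.

Lemma is_derive_oscillatory_moment n f g tau : mu.-integrable B (EFin \o f) ->
  mu.-integrable B (EFin \o g) ->
  is_derive tau 1 (oscillatory_moment n f g) (oscillatory_moment n.+1 (\- g) f tau).
Proof.
move=> intf intg.
have tauI : `]tau - 1, tau + 1[%classic tau by rewrite /= in_itv/=; apply/andP; split; lra.
have d1E x t : partial1of2 (oscillation n f g) x t = oscillation n.+1 (\- g) f x t.
  by rewrite partial1of2E; have [_ ->] := is_derive_oscillation n f g t x.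
have intN : mu.-integrable B (EFin \o (\- g)).
  by rewrite (_ : _ \o _ = (\- (EFin \o g))%E)//; exact: integrableN.
pose G t := M ^+ n.+1 * (`|g t| + `|f t|).
have intG : mu.-integrable B (EFin \o G) by exact: integrable_weight.
have G0 t : 0 <= G t by rewrite mulr_ge0 ?exprn_ge0 ?addr_ge0.
have ub x t : `]tau - 1, tau + 1[%classic x -> B t ->
    `|partial1of2 (oscillation n f g) x t| <= G t.
  by move=> _ Bt; rewrite d1E (le_trans (oscillation_le _ _ _ _ Bt))//= normrN.
have intosc x : `]tau - 1, tau + 1[%classic x ->
    mu.-integrable B (EFin \o oscillation n f g x).
  by move=> _; exact: integrable_oscillation.
have der x t : `]tau - 1, tau + 1[%classic x -> B t ->
    derivable ((oscillation n f g)^~ t) x 1.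
  by move=> _ _; have [] := is_derive_oscillation n f g t x.
apply: DeriveDef.
  exact: (derivable_under_integral mB tauI intosc der G0 intG ub).
rewrite -derive1E (differentiation_under_integral mB tauI intosc der G0 intG ub).
by apply: eq_Rintegral => t _; rewrite d1E.
Qed.

Lemma continuous_oscillatory_moment n f g : mu.-integrable B (EFin \o f) ->
  mu.-integrable B (EFin \o g) -> continuous (oscillatory_moment n f g).
Proof.
move=> intf intg tau; apply: differentiable_continuous; apply/derivable1_diffP.
by have [] := is_derive_oscillatory_moment n tau intf intg.
Qed.

Lemma oscillatory_momentN n f g tau : mu.-integrable B (EFin \o f) ->
  mu.-integrable B (EFin \o g) ->
  oscillatory_moment n (\- f) (\- g) tau = - oscillatory_moment n f g tau.
Proof.
move=> intf intg; rewrite -mulN1r -RintegralZl//; last exact: integrable_oscillation.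
by apply: eq_Rintegral => t _; rewrite /oscillation /=; ring.
Qed.

(** A function vanishing on an open interval has zero derivative there. Differentiation exchanges
    the two components up to sign, so the induction carries both. *)
Lemma oscillatory_moment_eq0 f g a b : mu.-integrable B (EFin \o f) ->
  mu.-integrable B (EFin \o g) ->
  (forall tau, a < tau < b ->
    oscillatory_moment 0 f g tau = 0 /\ oscillatory_moment 0 (\- g) f tau = 0) ->
  forall n tau, a < tau < b ->
    oscillatory_moment n f g tau = 0 /\ oscillatory_moment n (\- g) f tau = 0.
Proof.
move=> intf intg H.
have intN h : mu.-integrable B (EFin \o h) -> mu.-integrable B (EFin \o (\- h)).
  by move=> inth; rewrite (_ : _ \o _ = (\- (EFin \o h))%E)//; exact: integrableN.
have der0 (h : R -> R) (tau l : R) : is_derive tau 1 h l ->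
    (forall s, a < s < b -> h s = 0) -> a < tau < b -> l = 0.
  move=> hl h0 tauab.
  have : is_derive tau 1 (cst 0 : R -> R) l.
    apply: near_eq_is_derive hl.
    have := near_in_itvoo (_ : tau \in `]a, b[); rewrite in_itv/= => /(_ tauab).
    by apply: filterS => s; rewrite in_itv/= => /h0 ->.
  by move=> [_ <-]; rewrite derive_cst.
elim=> [//|n IH] tau tauab; split.
- have := is_derive_oscillatory_moment n tau (intN _ intg) intf.
  move=> /der0 /(_ (fun s sab => (IH s sab).2) tauab).
  by rewrite oscillatory_momentN// => /eqP; rewrite oppr_eq0 => /eqP.
- have := is_derive_oscillatory_moment n tau intf intg.
  by move=> /der0 /(_ (fun s sab => (IH s sab).1) tauab).
Qed.

(** Continuity upgrades the almost everywhere identity to all of []0, K[], differentiation gives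
    every order [n], and continuity at [0] removes the oscillation, since the cosine is [1] and the
    sine [0] there. *)
Lemma moment_eq0 f g K : mu.-integrable B (EFin \o f) ->
  mu.-integrable B (EFin \o g) -> 0 < K ->
  {ae (@lebesgue_measure R), forall tau, `]0, K[%classic tau ->
    oscillatory_moment 0 f g tau = 0 /\ oscillatory_moment 0 (\- g) f tau = 0} ->
  forall n, \int[mu]_(t in B) (S t ^+ n * f t) = 0.
Proof.
move=> intf intg K0 H n.
have intN : mu.-integrable B (EFin \o (\- g)).
  by rewrite (_ : _ \o _ = (\- (EFin \o g))%E)//; exact: integrableN.
have := @continuous_eq0_left R (oscillatory_moment n f g) 0 K
  (continuous_oscillatory_moment intf intg) K0.
rewrite {2}/oscillatory_moment; under eq_Rintegral do
  rewrite /oscillation mul0r cos0 sin0 mul1r mul0r subr0.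
apply => tau tau0K.
apply: (fun h => (oscillatory_moment_eq0 intf intg h n tau0K).1) => {n tau tau0K}.
move=> tau tau0K; split.
- apply: (continuous_ae_eq0 (continuous_oscillatory_moment intf intg) _ tau0K).
  by apply: filterS H; [exact: (ae_filter_ringOfSetsType (@lebesgue_measure R))|move=> s Hs /Hs[]].
- apply: (continuous_ae_eq0 (continuous_oscillatory_moment intN intf) _ tau0K).
  by apply: filterS H; [exact: (ae_filter_ringOfSetsType (@lebesgue_measure R))|move=> s Hs /Hs[]].
Qed.

End moments.

(** * Bounded multipliers, extension by zero and a lower bound for integrals *)

Section restriction.
Context d (T : measurableType d) (R : realType) (mu : {measure set T -> \bar R}).
Implicit Types (A B : set T) (f h : T -> R).

Lemma integrable_bounded_mul A h f C : measurable A -> measurable_fun A h ->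
  (forall t, A t -> `|h t| <= C) -> mu.-integrable A (EFin \o f) ->
  mu.-integrable A (EFin \o (fun t => h t * f t)).
Proof.
move=> mA mh hC intf; have := intf => /integrableP[/measurable_EFinP mf _].
have intC : mu.-integrable A (fun t => (C%:E * (`|f t|)%:E)%E).
  by apply: integrableZl => //; exact: (integrable_norm intf).
apply: (le_integrable mA _ _ intC) => [|t At /=].
  by apply/measurable_EFinP; exact: measurable_funM.
by rewrite lee_fin normrM (le_trans _ (ler_norm _))// ler_wpM2r// hC.
Qed.

Lemma integrable_cst_lty A (r : R) : measurable A -> (mu A < +oo)%E ->
  mu.-integrable A (EFin \o cst r).
Proof.
move=> mA muA; apply/integrableP; split; first exact/measurable_EFinP.
by rewrite /comp/= (integral_cst _ mA (`|r|%:E)%E) lte_mul_pinfty.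
Qed.

Lemma integrable_restrictW A B f : measurable A -> measurable B -> A `<=` B ->
  mu.-integrable A (EFin \o f) -> mu.-integrable B (EFin \o (f \_ A)).
Proof.
move=> mA mB AB; rewrite -restrict_EFin => intf.
by apply/(integrable_restrict mu mA mB); rewrite (setIidr AB).
Qed.

Lemma Rintegral_mul_restrict A B h f : A `<=` B ->
  \int[mu]_(t in B) (h t * (f \_ A) t) = \int[mu]_(t in A) (h t * f t).
Proof.
move=> AB; rewrite -[in RHS](setIidr AB) Rintegral_mkcondr.
by apply: eq_Rintegral => t _; rewrite !patchE; case: ifPn => // _; rewrite mulr0.
Qed.

Lemma Rintegral_ge_cst A E f m : measurable A -> measurable E -> E `<=` A ->
  mu.-integrable A (EFin \o f) -> (forall t, A t -> 0 <= f t) ->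
  (forall t, E t -> m <= f t) -> m * fine (mu E) <= \int[mu]_(t in A) f t.
Proof.
move=> mA mE EA intf f0 mf; rewrite -Rintegral_cst//.
(* If [E] has infinite measure, [fine] returns [0] and the claim is nonnegativity of the
   integral. *)
have [muE|muE] := ltP (mu E) +oo%E; last first.
  rewrite Rintegral_cst//; move: muE; rewrite leye_eq => /eqP ->.
  by rewrite mulr0 Rintegral_ge0.
have intE : mu.-integrable E (EFin \o cst m) by exact: integrable_cst_lty.
rewrite -(setIidr EA) Rintegral_mkcondr; apply: le_Rintegral => //.
  exact: integrable_restrictW.
by move=> t At; rewrite patchE; case: ifPn => [/set_mem/mf//|_]; exact: f0.
Qed.

Lemma integrable_bounded_lty A f C : measurable A -> (mu A < +oo)%E ->
  measurable_fun A f -> (forall t, A t -> `|f t| <= C) ->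
  mu.-integrable A (EFin \o f).
Proof.
move=> mA muA mf fC.
have := integrable_bounded_mul mA mf fC (integrable_cst_lty 1 mA muA).
by under [in X in X -> _]eq_fun do rewrite /= mulr1.
Qed.

End restriction.

(** * Growth of centred moments *)

Section separation.
Context d (T : measurableType d) (R : realType) (mu : {measure set T -> \bar R}).
Variables (B : set T) (mB : measurable B) (muB : (mu B < +oo)%E).
Variables (S : T -> R) (mS : measurable_fun B S).
Variables (M : R) (M0 : 0 <= M) (SM : forall t, B t -> `|S t| <= M).

(** Centring is done one factor [S - c] at a time. The induction is on mixed products
    [(S - c)^m S^k] for all [k], because splitting off [S - c] shifts a factor [S] into the second
    power. *)
Lemma shifted_moment_eq0 (f : T -> R) (c : R) : mu.-integrable B (EFin \o f) ->
  (forall n, \int[mu]_(t in B) (S t ^+ n * f t) = 0) ->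
  forall n, \int[mu]_(t in B) ((S t - c) ^+ n * f t) = 0.
Proof.
move=> intf H n.
have int_poly m k : mu.-integrable B (EFin \o (fun t => (S t - c) ^+ m * S t ^+ k * f t)).
  apply: (integrable_bounded_mul (C := (M + `|c|) ^+ m * M ^+ k)) => //.
    apply: measurable_funM; last exact: measurable_funX.
    by apply: measurable_funX; exact: measurable_funB.
  move=> t Bt; rewrite normrM !normrX ler_pM ?exprn_ge0// lerXn2r ?nnegrE ?addr_ge0//.
    by rewrite (le_trans (ler_normB _ _))// lerD2r SM.
  exact: SM.
suff K : forall m k, \int[mu]_(t in B) ((S t - c) ^+ m * S t ^+ k * f t) = 0.
  by rewrite -[RHS](K n 0%N); apply: eq_Rintegral => t _; rewrite expr0 mulr1.
elim=> [|m IH] k.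
  by rewrite -[RHS](H k); apply: eq_Rintegral => t _; rewrite expr0 mul1r.
transitivity (\int[mu]_(t in B) ((S t - c) ^+ m * S t ^+ k.+1 * f t -
    c * ((S t - c) ^+ m * S t ^+ k * f t))).
  by apply: eq_Rintegral => t _; rewrite !exprS; ring.
rewrite RintegralB//; last first.
  exact: (integrableZl mB c (int_poly m k)).
by rewrite RintegralZl// !IH mulr0 subrr.
Qed.

(* The moments of [u] on [A] grow like [beta ^ n], those of the constant [k] on [A']
   at least like [gamma ^ n]. *)
Lemma moments_separated (A A' E : set T) (u : T -> R) (k c beta gamma : R) :
  measurable A -> measurable A' -> measurable E ->
  A `<=` B -> A' `<=` B -> E `<=` A' -> (0 < mu E)%E ->
  mu.-integrable A (EFin \o u) -> 0 < k -> 0 <= beta < gamma ->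
  (forall t, A t -> `|S t - c| <= beta) ->
  (forall t, E t -> gamma <= `|S t - c|) ->
  ~ (forall n, \int[mu]_(t in B) (S t ^+ n * ((u \_ A) t - (cst k \_ A') t)) = 0).
Proof.
move=> mA mA' mE AB A'B EA' muE intu k0 /andP[beta0 bg] SA SE H.
have muA' : (mu A' < +oo)%E.
  by apply: le_lt_trans muB; apply: le_measure; rewrite ?inE.
have intk : mu.-integrable A' (EFin \o cst k) by exact: integrable_cst_lty.
have intuB : mu.-integrable B (EFin \o (u \_ A)) by exact: integrable_restrictW.
have intkB : mu.-integrable B (EFin \o (cst k \_ A')) by exact: integrable_restrictW.
have intf : mu.-integrable B (EFin \o (fun t => (u \_ A) t - (cst k \_ A') t)).
  by rewrite /comp; under eq_fun do rewrite EFinB; exact: integrableB.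
pose p n t := (S t - c) ^+ n.
have mp n A0 : measurable A0 -> A0 `<=` B -> measurable_fun A0 (p n).
  move=> mA0 A0B; apply: (measurable_funS mB A0B).
  by apply: measurable_funX; exact: measurable_funB.
have pM n t : B t -> `|p n t| <= (M + `|c|) ^+ n.
  move=> Bt; rewrite normrX lerXn2r ?nnegrE ?addr_ge0//.
  by rewrite (le_trans (ler_normB _ _))// lerD2r SM.
have eqAA' n : \int[mu]_(t in A) (p n t * u t) = \int[mu]_(t in A') (p n t * k).
  rewrite -(Rintegral_mul_restrict mu _ _ AB) -(Rintegral_mul_restrict mu _ (cst k) A'B).
  apply/eqP; rewrite -subr_eq0 -RintegralB//; last 2 first.
  - by apply: integrable_bounded_mul (pM n) _ => //; exact: mp.
  - by apply: integrable_bounded_mul (pM n) _ => //; exact: mp.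
  rewrite -[X in _ == X](shifted_moment_eq0 c intf H n).
  by apply/eqP/eq_Rintegral => t _; rewrite mulrBr.
pose U := \int[mu]_(t in A) `|u t|.
have up n : \int[mu]_(t in A) (p n t * u t) <= beta ^+ n * U.
  have intpu : mu.-integrable A (EFin \o (fun t => p n t * u t)).
    apply: integrable_bounded_mul (fun t At => pM n t (AB _ At)) _ => //.
    exact: mp.
  rewrite (le_trans (ler_norm _))// (le_trans (le_normr_Rintegral _ _))//.
  rewrite -RintegralZl//; last exact: (integrable_norm intu).
  apply: le_Rintegral => //.
  - exact: (integrable_norm intpu).
  - apply: (integrable_bounded_mul (h := cst (beta ^+ n)) (C := beta ^+ n)) => //.
      by move=> t _ /=; rewrite ger0_norm ?exprn_ge0.
    exact: (integrable_norm intu).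
  - move=> t At /=; rewrite normrM ler_wpM2r// normrX.
    by rewrite lerXn2r ?nnegrE ?SA.
have low n : gamma ^+ n.*2 * k * fine (mu E) <= \int[mu]_(t in A') (p n.*2 t * k).
  apply: Rintegral_ge_cst => //.
  - apply: integrable_bounded_mul (fun t At => pM n.*2 t (A'B _ At)) _ => //.
    exact: mp.
  - by move=> t _; rewrite mulr_ge0 ?(ltW k0)// /p exprn_even_ge0// odd_double.
  - move=> t Et; rewrite ler_wpM2r ?(ltW k0)// /p -[leRHS]ger0_norm ?normrX.
      by rewrite lerXn2r ?nnegrE ?SE// ltW// (le_lt_trans beta0).
    by rewrite exprn_even_ge0// odd_double.
have gamma0 : 0 < gamma by exact: le_lt_trans bg.
(* After division by [gamma ^+ n.*2], the two bounds place the positive number [k * fine (mu E)]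
   below [x ^+ n * U], which tends to [0]. *)
pose x := (beta / gamma) ^+ 2.
have x0 : 0 <= x by rewrite sqr_ge0.
have x1 : `|x| < 1.
  rewrite ger0_norm// /x expr_lt1// ?divr_ge0 ?(ltW gamma0)//.
  by rewrite ltr_pdivrMr ?mul1r.
have m0 : 0 < k * fine (mu E).
  rewrite mulr_gt0// fine_gt0// muE/= (le_lt_trans _ muA')//.
  by apply: le_measure; rewrite ?inE.
have bound n : k * fine (mu E) <= x ^+ n * U.
  have := le_trans (low n) (le_trans (_ : _ <= _) (up n.*2)).
  rewrite -eqAA' => /(_ (lexx _)).
  rewrite /x -exprM mul2n expr_div_n -mulrA mulrAC ler_pdivlMr ?exprn_gt0//.
  by rewrite (mulrC (k * _)).
have cvgU : (fun n => x ^+ n * U) @ \oo --> (0 * U : R).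
  by apply: cvgMr_tmp; exact: cvg_expr.
have : k * fine (mu E) <= 0 * U.
  by apply: (cvgr_to_ge cvgU); apply: nearW; exact: bound.
by rewrite mul0r leNgt m0.
Qed.

End separation.

(** * Obstruction to membership in the range *)

Section range_obstruction.
Variable R : realType.
Implicit Types (x y z : pt R) (D : set (pt R)).

Lemma sqrt_sum_sqr_le (a b c : R) :
  Num.sqrt (a ^+ 2 + b ^+ 2 + c ^+ 2) <= `|a| + `|b| + `|c|.
Proof.
rewrite -[leRHS]ger0_norm ?addr_ge0// -sqrtr_sqr ler_wsqrtr//.
rewrite -(real_normK (num_real a)) -(real_normK (num_real b)) -(real_normK (num_real c)).
have := normr_ge0 a; have := normr_ge0 b; have := normr_ge0 c; nra.
Qed.

Lemma bounded3_ball3 y (e : R) : bounded3 (ball3 y e).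
Proof.
exists (`|y.1.1| + `|y.1.2| + `|y.2| + 3 * e + 1) => z /ball3_sub_box3[[/= h1 h2] h3].
apply: (le_lt_trans (sqrt_sum_sqr_le _ _ _)); rewrite !sub0r !normrN.
have nb (a b : R) : ball a e b -> `|b| <= `|a| + e.
  rewrite /ball/= => ab; rewrite -(subrK a b) addrC.
  by rewrite (le_trans (ler_normD _ _))// lerD2l distrC ltW.
by have := nb _ _ h1; have := nb _ _ h2; have := nb _ _ h3; lra.
Qed.

Lemma dist3_bounded x D : bounded3 D ->
  exists2 C, 0 <= C & forall z, D z -> dist3 x z <= C.
Proof.
move=> [M DM]; have [M0|M0] := leP 0 M; last first.
  exists 0 => // z /DM; rewrite ltNge => /negP; case.
  by rewrite (le_trans (ltW M0)) ?dist3_ge0.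
exists ((`|x.1.1| + M) + (`|x.1.2| + M) + (`|x.2| + M)).
  by rewrite !addr_ge0.
move=> z /DM zM; have [h1 h2 h3] := dist3_coord_le (pt0 R) z.
have coord (a b : R) : `|0 - b| <= dist3 (pt0 R) z -> `|a - b| <= `|a| + M.
  move=> h; rewrite (le_trans (ler_normB _ _))// lerD2l.
  by move: h; rewrite sub0r normrN => /le_trans; apply; exact: ltW.
apply: (@le_trans _ _ (`|x.1.1 - z.1.1| + `|x.1.2 - z.1.2| + `|x.2 - z.2|)); last first.
  by rewrite !lerD// coord.
exact: sqrt_sum_sqr_le.
Qed.

Lemma lebST_X_lty D (a b : R) : measurable D -> (leb3 D < +oo)%E ->
  (lebST (D `*` `]a, b[) < +oo)%E.
Proof.
move=> mD Dlty; rewrite lebSTE product_measure1E//.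
rewrite lte_mul_pinfty ?ge0_fin_numE//.
rewrite /lam [ltLHS](@lebesgue_measure_itv R `]a, b[).
by case: ifP => _; rewrite ltry.
Qed.

Lemma lebST_X_gt0 D y (a b : R) : measurable D -> nbhs y D -> a < b ->
  (0 < lebST (D `*` `]a, b[))%E.
Proof.
move=> mD yD ab; rewrite lebSTE product_measure1E// mule_gt0//.
  exact: leb3_nbhs_gt0 yD.
rewrite /lam [ltRHS](@lebesgue_measure_itv R `]a, b[)/= lte_fin ab.
by rewrite -EFinB lte_fin subr_gt0.
Qed.

Lemma measurable_travel_time x :
  measurable_fun setT (fun yt : pt R * R => yt.2 + dist3 x yt.1).
Proof.
apply: measurable_funD => //.
exact: (measurableT_comp (measurable_dist3 x) measurable_fst).
Qed.

(** On a set of finite measure [L^2] lies in [L^1], because [|a| <= 1 + a^2 + b^2]. *)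
Lemma in_L2_integrable (A : set (pt R * R)) ur ui : measurable A ->
  (lebST A < +oo)%E -> in_L2 A ur ui ->
  (@lebST R).-integrable A (EFin \o ur) /\ (@lebST R).-integrable A (EFin \o ui).
Proof.
move=> mA Alty [mr mi sqlty].
have intsq : (@lebST R).-integrable A (EFin \o (fun t => ur t ^+ 2 + ui t ^+ 2)).
  apply/integrableP; split.
    by apply/measurable_EFinP; apply: measurable_funD; exact: measurable_funX.
  apply: le_lt_trans sqlty; rewrite le_eqVlt; apply/orP; left; apply/eqP.
  by apply: eq_integral => t _ /=; rewrite ger0_norm// addr_ge0 ?sqr_ge0.
have int1 : (@lebST R).-integrable A
    (EFin \o (fun t => 1 + (ur t ^+ 2 + ui t ^+ 2))).
  rewrite /comp; under eq_fun do rewrite EFinD.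
  by apply: integrableD => //; exact: (integrable_cst_lty 1 mA Alty).
have le1 (a b : R) : `|a| <= 1 + (a ^+ 2 + b ^+ 2) /\ `|b| <= 1 + (a ^+ 2 + b ^+ 2).
  rewrite -(real_normK (num_real a)) -(real_normK (num_real b)).
  by have := sqr_ge0 (`|a| - 1); have := sqr_ge0 (`|b| - 1); split; nra.
split; apply: (le_integrable mA _ _ int1) => [|t At /=]; try exact/measurable_EFinP.
- by rewrite lee_fin (le_trans (le1 (ur t) (ui t)).1)// ler_norm.
- by rewrite lee_fin (le_trans (le1 (ur t) (ui t)).2)// ler_norm.
Qed.

Lemma phi_coef_gt0 (tmin eta eps : R) y : tmin < eta -> 0 < eps ->
  0 < phi_coef tmin y eta eps.
Proof.
move=> te e0; rewrite /phi_coef invr_gt0 mulr_gt0 ?subr_gt0// fine_gt0//.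
rewrite leb3_ball3_lty andbT.
by apply: (@leb3_nbhs_gt0 _ y); [exact: open_measurable3 (@open_ball3 _ _ _)|exact: nbhs_ball3].
Qed.

(** A preimage and the test density, both extended by zero to the union [B] of the two cylinders,
    would have equal moments of the travel time. This contradicts [moments_separated]: the travel
    time stays within [beta] of [c] over [D], but is at least [gamma] away from it on [E]. *)
Lemma not_in_range_LD D x y (tmin tmax K eta eps c beta gamma : R) (E : set (pt R * R)) :
  open D -> bounded3 D -> 0 < K -> tmin < eta -> 0 < eps -> 0 <= beta < gamma ->
  (forall z t, D z -> tmin < t < tmax -> `|t + dist3 x z - c| <= beta) ->
  measurable E -> (0 < lebST E)%E -> E `<=` ball3 y eps `*` `]tmin, eta[ ->
  (forall z t, E (z, t) -> gamma <= `|t + dist3 x z - c|) ->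
  ~ in_range_LD D tmin tmax x K (phi_re tmin x y eta eps) (phi_im tmin x y eta eps).
Proof.
move=> oD bD K0 te e0 bg SA mE E0 EA' SE [ur [ui [L2u ae]]].
have mD := open_measurable3 oD.
have mBall := open_measurable3 (@open_ball3 _ y eps).
pose A := STdom D tmin tmax; pose A' := ball3 y eps `*` `]tmin, eta[.
have mA : measurable A by apply: measurableX.
have mA' : measurable A' by apply: measurableX.
have Alty : (lebST A < +oo)%E.
  by apply: lebST_X_lty => //; exact: bounded3_leb3_lty.
have A'lty : (lebST A' < +oo)%E by apply: lebST_X_lty => //; exact: leb3_ball3_lty.
pose B := A `|` A'.
have mB : measurable B by exact: measurableU.
have Blty : (lebST B < +oo)%E.
  by apply: (le_lt_trans (measureU2 _ mA mA')); exact: lte_add_pinfty.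
have AB : A `<=` B by move=> ?; left.
have A'B : A' `<=` B by move=> ?; right.
pose S (yt : pt R * R) := yt.2 + dist3 x yt.1.
have mS : measurable_fun B S by apply: measurable_funTS; exact: measurable_travel_time.
have [C1 C10 DC1] := dist3_bounded x bD.
have [C2 C20 BC2] : exists2 C, 0 <= C & forall z, ball3 y eps z -> dist3 x z <= C.
  exact/dist3_bounded/bounded3_ball3.
(* A crude bound for the travel time on both cylinders: the first three terms control the times,
   [C1] and [C2] the distances. *)
pose M := `|tmin| + `|tmax| + `|eta| + C1 + C2.
have M0 : 0 <= M by rewrite /M !addr_ge0.
have SM t : B t -> `|S t| <= M.
  case: t => z t; rewrite /S/= => -[|] [/= hz].
  - rewrite in_itv/= => /andP[t1 t2]; have := DC1 _ hz; have := dist3_ge0 x z.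
    rewrite ler_norml /M => d0 dC.
    have := ler_norm tmin; have := ler_norm (- tmin); rewrite normrN.
    have := ler_norm tmax; have := ler_norm (- tmax); rewrite normrN.
    by have := normr_ge0 eta => *; apply/andP; split; lra.
  - rewrite in_itv/= => /andP[t1 t2]; have := BC2 _ hz; have := dist3_ge0 x z.
    rewrite ler_norml /M => d0 dC.
    have := ler_norm tmin; have := ler_norm (- tmin); rewrite normrN.
    have := ler_norm eta; have := ler_norm (- eta); rewrite normrN.
    by have := normr_ge0 tmax => *; apply/andP; split; lra.
have [intr inti] := in_L2_integrable mA Alty L2u.
have k0 := phi_coef_gt0 y te e0; set k := phi_coef tmin y eta eps in k0.
have intk : (@lebST R).-integrable A' (EFin \o cst k) by exact: integrable_cst_lty.
have intrB := integrable_restrictW mA mB AB intr.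
have intiB := integrable_restrictW mA mB AB inti.
have intkB := integrable_restrictW mA' mB A'B intk.
(* The test density is the real constant [k] on [A'], so it enters the real part only. *)
pose f t := (ur \_ A) t - (cst k \_ A') t.
pose g := ui \_ A.
have intf : (@lebST R).-integrable B (EFin \o f).
  by rewrite /comp; under eq_fun do rewrite EFinB; exact: integrableB.
apply: (@moments_separated _ _ R (@lebST R) B mB Blty S mS M M0 SM A A' E ur k c beta gamma) => //.
- by case=> z t [/= Dz]; rewrite in_itv/=; exact: SA.
- by case=> z t; exact: SE.
apply: (@moment_eq0 _ _ R (@lebST R) B mB S mS M M0 SM f g K) => //.
apply: filterS ae; first exact: (ae_filter_ringOfSetsType (@lebesgue_measure R)).
move=> tau H tauK; have [{H}re im] := H tauK.
have mtrig (h : R -> R) : continuous h -> forall A0, measurable A0 ->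
    measurable_fun A0 (fun t => h (tau * S t)).
  move=> ch A0 mA0; apply: (@measurable_funS _ _ _ _ setT) => //.
  apply: (measurableT_comp (f := h)); first exact: continuous_measurable_fun.
  by apply: measurable_funM => //; exact: measurable_travel_time.
have mcos := mtrig _ (@continuous_cos R); have msin := mtrig _ (@continuous_sin R).
have cosM (t : pt R * R) : `|cos (tau * S t)| <= 1 by rewrite ler_norml cos_geN1 cos_le1.
have sinM (t : pt R * R) : `|sin (tau * S t)| <= 1 by rewrite ler_norml sin_geN1 sin_le1.
have intM (h u : pt R * R -> R) A0 : measurable A0 -> measurable_fun A0 h ->
    (forall t, `|h t| <= 1) -> (@lebST R).-integrable A0 (EFin \o u) ->
    (@lebST R).-integrable A0 (EFin \o (fun t => h t * u t)).
  by move=> mA0 mh h1; apply: integrable_bounded_mul (fun t _ => h1 t).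
have phiE (h : pt R * R -> R) : measurable_fun A' h -> (forall t, `|h t| <= 1) ->
    \int[@lebST R]_(t in B) (h t * (cst k \_ A') t) = k * \int[@lebST R]_(t in A') h t.
  move=> mh h1; rewrite Rintegral_mul_restrict// -RintegralZl//.
    by apply: eq_Rintegral => t _; rewrite mulrC.
  exact: integrable_bounded_lty (fun t _ => h1 t).
(* The first component is the real part of the range identity, the second is minus its imaginary
   part. *)
split; rewrite /oscillatory_moment /oscillation.
- transitivity (\int[@lebST R]_(t in B) ((cos (tau * S t) * (ur \_ A) t -
      sin (tau * S t) * (ui \_ A) t) - cos (tau * S t) * (cst k \_ A') t)).
    by apply: eq_Rintegral => t _; rewrite /f /g; ring.
  rewrite RintegralB//; [|rewrite /comp; under eq_fun do rewrite EFinB|]; last 2 first.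
  - by apply: integrableB => //; apply: intM => //; [exact: mcos|exact: msin].
  - by apply: intM => //; exact: mcos.
  rewrite phiE//; last exact: mcos.
  rewrite RintegralB//; last 2 first.
  - by apply: intM => //; exact: mcos.
  - by apply: intM => //; exact: msin.
  rewrite !Rintegral_mul_restrict// -RintegralB//; last 2 first.
  - by apply: intM => //; exact: mcos.
  - by apply: intM => //; exact: msin.
  by apply/eqP; rewrite subr_eq0; apply/eqP; exact: re.
- transitivity (\int[@lebST R]_(t in B) (cos (tau * S t) * - (ui \_ A) t
      - sin (tau * S t) * (ur \_ A) t + sin (tau * S t) * (cst k \_ A') t)).
    by apply: eq_Rintegral => t _; rewrite /f /g/=; ring.
  transitivity (\int[@lebST R]_(t in B) (sin (tau * S t) * (cst k \_ A') t -
     (sin (tau * S t) * (ur \_ A) t + cos (tau * S t) * (ui \_ A) t))).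
    by apply: eq_Rintegral => t _; ring.
  rewrite RintegralB//; [|by apply: intM => //; exact: msin|]; last first.
    rewrite /comp; under eq_fun do rewrite EFinD.
    by apply: integrableD => //; apply: intM => //; [exact: msin|exact: mcos].
  rewrite phiE//; last exact: msin.
  rewrite RintegralD//; last 2 first.
  - by apply: intM => //; exact: msin.
  - by apply: intM => //; exact: mcos.
  rewrite !Rintegral_mul_restrict// -RintegralD//; last 2 first.
  - by apply: intM => //; exact: msin.
  - by apply: intM => //; exact: mcos.
  by apply/eqP; rewrite subr_eq0; apply/eqP/esym; exact: im.
Qed.

End range_obstruction.

(** * Points outside the closed enlarged annulus *)

Section annuli.
Variable R : realType.
Implicit Types (x y z : pt R) (D : set (pt R)).

(** Sliding [y] along its ray from [x] changes the distance continuously, so a boundary point can be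
    pushed slightly into the open annulus. *)
Lemma closure_annulus x y (a b : R) : 0 <= a -> a < b -> a <= dist3 x y <= b ->
  closure [set z | a < dist3 x z < b] y.
Proof.
move=> a0 ab /andP[ay yb] U yU.
have [g [cg gy gs]] := dist3_ray x y.
set r := dist3 x y in ay yb gy.
have : nbhs r (g @^-1` U) by apply: cg; rewrite gy.
move=> /nbhs_ballP[e /= e0 reU].
have [s [sa sb rs]] : exists s, [/\ a < s, s < b & `|r - s| < e].
  (* Move outward from the inner half and inward from the outer half; a step of at most a quarter of
     the width cannot overshoot. *)
  have [rm|mr] := ltP r ((a + b) / 2).
    exists (r + Num.min (e / 2) ((b - a) / 4)).
    have m0 : 0 < Num.min (e / 2) ((b - a) / 4) by rewrite lt_min !divr_gt0// subr_gt0.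
    have m1 : Num.min (e / 2) ((b - a) / 4) <= e / 2 by rewrite ge_min lexx.
    have m2 : Num.min (e / 2) ((b - a) / 4) <= (b - a) / 4 by rewrite ge_min lexx orbT.
    by split; rewrite ?opprD ?addNKr ?normrN ?gtr0_norm//; lra.
  exists (r - Num.min (e / 2) ((b - a) / 4)).
  have m0 : 0 < Num.min (e / 2) ((b - a) / 4) by rewrite lt_min !divr_gt0// subr_gt0.
  have m1 : Num.min (e / 2) ((b - a) / 4) <= e / 2 by rewrite ge_min lexx.
  have m2 : Num.min (e / 2) ((b - a) / 4) <= (b - a) / 4 by rewrite ge_min lexx orbT.
  by split; rewrite ?opprB ?subrKC ?gtr0_norm//; lra.
exists (g s); split; last exact: reU.
by rewrite /= gs ?sa// (le_trans a0) ?ltW.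
Qed.

Section domain.
Variables (D : set (pt R)) (x : pt R).
Hypotheses (oD : open D) (D0 : D !=set0) (bD : bounded3 D).

Lemma dist_set_bounds z : D z -> inf (dist_set x D) <= dist3 x z <= sup (dist_set x D).
Proof.
move=> Dz; have [C _ HC] := dist3_bounded x bD; apply/andP; split.
  by apply: ge_inf; [exists 0 => _ [w _ <-]; exact: dist3_ge0|exists z].
by apply: ub_le_sup; [exists C => _ [w /HC ? <-]|exists z].
Qed.

Lemma inf_dist_set_ge0 : 0 <= inf (dist_set x D).
Proof.
have [z Dz] := D0; apply: lb_le_inf; first by exists (dist3 x z), z.
by move=> _ [w _ <-]; exact: dist3_ge0.
Qed.

(** As [D] is open, a point of [D] can be moved outward along its ray within [D], which strictly
    increases the distance. *)
Lemma inf_lt_sup_dist_set : inf (dist_set x D) < sup (dist_set x D).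
Proof.
have [z Dz] := D0; have [g [cg gz gs]] := dist3_ray x z.
have : nbhs (dist3 x z) (g @^-1` D) by apply: cg; rewrite gz; exact: open_nbhs_nbhs.
move=> /nbhs_ballP[e /= e0 He].
have /andP[iz _] := dist_set_bounds Dz.
have /dist_set_bounds/andP[_] : D (g (dist3 x z + e / 2)).
  by apply: He; rewrite /ball/= opprD addNKr normrN gtr0_norm//; lra.
by rewrite gs; [lra|have := dist3_ge0 x z; lra].
Qed.

(** Over [D] the travel time lies in [[tmin + a, tmax + b]]. The test density charges values beyond
    one end of this interval; taking for [c] the opposite end makes [beta] the length of the
    interval and [gamma] strictly larger. *)
Lemma not_in_range_outside_annulus (tmin tmax K eta eps : R) y : 0 < K -> 0 <= tmin ->
  tmin < eta <= tmax -> 0 < eps -> ~ closure (annulus_D_eta D tmax eta x) y ->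
  ~ in_range_LD D tmin tmax x K (phi_re tmin x y eta eps) (phi_im tmin x y eta eps).
Proof.
move=> K0 tmin0 /andP[te etm] e0 ny.
set a := inf (dist_set x D); set b := sup (dist_set x D).
have a0 : 0 <= a := inf_dist_set_ge0.
have ab : a < b := inf_lt_sup_dist_set.
have Sbounds z t : D z -> tmin < t < tmax -> tmin + a <= t + dist3 x z <= tmax + b.
  by move=> /dist_set_bounds/andP[h1 h2] /andP[t1 t2]; apply/andP; split; apply: lerD => //; exact: ltW.
pose near (g : R) := ball3 y eps `&` dist3 x @^-1` ball (dist3 x y) g.
have near_open g : open (near g).
  apply: openI; first exact: open_ball3.
  by apply: open_comp => [z _|]; [exact: continuous_dist3|exact: ball_open].
have near_nbhs g : 0 < g -> nbhs y (near g).
  move=> g0; apply: open_nbhs_nbhs; split; first exact: near_open.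
  by split; [rewrite /ball3/= dist3xx|exact: ballxx].
(* The closure contains the whole closed annulus, equality cases included, so both inequalities are
   strict. *)
have [ylo|yhi] : dist3 x y < a \/ b + tmax - eta < dist3 x y.
  have [/ltW ya|] := ltP a (dist3 x y); last first.
    rewrite le_eqVlt => /predU1P[ya|]; last by left.
    exfalso; apply: ny; apply: closure_annulus => //; first by rewrite -/b; lra.
    by rewrite -/a -/b ya lexx/=; lra.
  have [|yb] := ltP (b + tmax - eta) (dist3 x y); first by right.
  exfalso; apply: ny; apply: closure_annulus => //; first by rewrite -/a -/b; lra.
  by rewrite -/a -/b ya.
(* One third of the gap absorbs the variation of the distance near [y], one third that of the time
   just after [tmin], and the last third remains as [gamma - beta]. *)
- pose g := (a - dist3 x y) / 3.
  have g0 : 0 < g by rewrite divr_gt0// subr_gt0.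
  pose t1 := Num.min eta (tmin + g).
  have t1t : tmin < t1 by rewrite lt_min te ltrDl.
  have t1e : t1 <= eta by rewrite ge_min lexx.
  have t1g : t1 <= tmin + g by rewrite ge_min lexx orbT.
  have ag : a - dist3 x y = 3 * g by rewrite /g; lra.
  apply: (@not_in_range_LD R D x y tmin tmax K eta eps (tmax + b)
    (tmax + b - (tmin + a)) (tmax + b - (tmin + a) + g) (near g `*` `]tmin, t1[)) => //.
  + by rewrite ltrDl g0 andbT; lra.
  + move=> z t Dz tt; have /andP[h1 h2] := Sbounds z t Dz tt.
    by rewrite ler_norml; apply/andP; split; lra.
  + by apply: measurableX => //; exact: open_measurable3 (near_open _).
  + by apply: (@lebST_X_gt0 _ _ y) => //; [exact: open_measurable3 (near_open _)|exact: near_nbhs].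
  + move=> [z t] [/= [zy _]]; rewrite in_itv/= => /andP[h1 h2]; split => //=.
    by rewrite in_itv/= h1 (lt_le_trans h2).
  + move=> z t [/= [_ zg]]; rewrite in_itv/= => /andP[h1 h2].
    move: zg; rewrite /ball/= ltr_norml => /andP[z1 z2].
    rewrite ler0_norm; lra.
(* The mirror case: the times are taken just before [eta], and [c] is the lower end [tmin + a]. *)
- pose g := (dist3 x y - (b + tmax - eta)) / 3.
  have g0 : 0 < g by rewrite divr_gt0// subr_gt0.
  pose t1 := Num.max tmin (eta - g).
  have t1t : t1 < eta by rewrite gt_max te gtrDl oppr_lt0.
  have t1e : tmin <= t1 by rewrite le_max lexx.
  have t1g : eta - g <= t1 by rewrite le_max lexx orbT.
  have ag : dist3 x y - (b + tmax - eta) = 3 * g by rewrite /g; lra.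
  apply: (@not_in_range_LD R D x y tmin tmax K eta eps (tmin + a)
    (tmax + b - (tmin + a)) (tmax + b - (tmin + a) + g) (near g `*` `]t1, eta[)) => //.
  + by rewrite ltrDl g0 andbT; lra.
  + move=> z t Dz tt; have /andP[h1 h2] := Sbounds z t Dz tt.
    by rewrite ler_norml; apply/andP; split; lra.
  + by apply: measurableX => //; exact: open_measurable3 (near_open _).
  + by apply: (@lebST_X_gt0 _ _ y) => //; [exact: open_measurable3 (near_open _)|exact: near_nbhs].
  + move=> [z t] [/= [zy _]]; rewrite in_itv/= => /andP[h1 h2]; split => //=.
    by rewrite in_itv/= h2 (le_lt_trans t1e).
  + move=> z t [/= [_ zg]]; rewrite in_itv/= => /andP[h1 h2].
    move: zg; rewrite /ball/= ltr_norml => /andP[z1 z2].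
    rewrite ger0_norm; lra.
Qed.

End domain.
End annuli.

(** * Comparison of finite Borel measures on the line *)

Section domination.
Variable R : realType.
Implicit Type m : {finite_measure set (measurableTypeR R) -> \bar R}.

Definition distribution_function m (r : R) : R := fine (m `]-oo, r]%classic).

Lemma distribution_functionB m (a b : R) : a <= b ->
  distribution_function m b - distribution_function m a = fine (m `]a, b]%classic).
Proof.
move=> ab; rewrite /distribution_function.
have -> : `]-oo, b]%classic = `]-oo, a]%classic `|` `]a, b]%classic :> set (measurableTypeR R).
  by rewrite -itv_bndbnd_setU// bnd_simp.
rewrite measureU//; last first.
  rewrite -subset0 => r [/=]; rewrite !in_itv/= => ra /andP[ar _].
  by move: (lt_le_trans ar ra); rewrite ltxx.
by rewrite fineD ?fin_num_measure// addrAC subrr add0r.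
Qed.

(** The intervals []a, a + 1 / (n + 1)]] decrease to the empty set, so their measures tend to
    [0]. *)
Lemma distribution_function_right_continuous m :
  right_continuous (distribution_function m).
Proof.
move=> a; apply/cvgrPdist_lt => e e0.
pose F n := `]a, a + n.+1%:R^-1]%classic : set (measurableTypeR R).
have mF n : measurable (F n) by exact: measurable_itv.
have Fcap : \bigcap_n F n = set0.
  rewrite -subset0 => r Fr.
  have /andP[ar _] : a < r <= a + 1%:R^-1 by have := Fr 0%N I; rewrite /F/= in_itv.
  have /ltr_add_invr[n an] := ar.
  have := Fr n I; rewrite /F/= in_itv/= => /andP[_].
  by rewrite leNgt an.
have : m (F n) @[n --> \oo] --> m (\bigcap_n F n).
  apply: nonincreasing_cvg_mu => //.
  - by rewrite -ge0_fin_numE// fin_num_measure//; exact: mF.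
  - by apply: bigcap_measurable => // n _; exact: mF.
  - move=> i j ij; apply/subsetPset; apply: subset_itvl.
    by rewrite bnd_simp lerD2l lef_pV2 ?posrE// ler_nat.
rewrite Fcap measure0 => /fine_cvgP[_] /cvgrPdist_lt /(_ _ e0)[N _ /(_ N (leqnn N))].
rewrite sub0r normrN /= ger0_norm ?fine_ge0// => FNe.
near=> r.
have ar : a <= r by apply: ltW; near: r; exact: nbhs_right_gt.
rewrite distrC distribution_functionB// ger0_norm ?fine_ge0//.
apply: le_lt_trans FNe; apply: fine_le; rewrite ?fin_num_measure//.
apply: le_measure; rewrite ?inE//; apply: subset_itvl; rewrite bnd_simp.
by near: r; apply: nbhs_right_le; rewrite ltrDl invr_gt0.
Unshelve. all: by end_near. Qed.

Lemma lebesgue_stieltjes_ocitv (f : cumulative R R) (a b : R) : a <= b ->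
  lebesgue_stieltjes_measure f `]a, b]%classic = (f b - f a)%:E.
Proof.
move=> ab; rewrite /lebesgue_stieltjes_measure /measure_extension/=.
rewrite measurable_mu_extE/=; last exact: is_ocitv.
by rewrite wlength_itv_bnd.
Qed.

(* The difference of the distribution functions is again a distribution function:
   [m2] is the sum of [m1] and a Lebesgue-Stieltjes measure. *)
Lemma le_measure_of_le_ocitv (m1 m2 : {finite_measure set (measurableTypeR R) -> \bar R}) :
  (forall a b : R, a <= b -> (m1 `]a, b]%classic <= m2 `]a, b]%classic)%E) ->
  forall A, measurable A -> (m1 A <= m2 A)%E.
Proof.
move=> m12.
pose G r := distribution_function m2 r - distribution_function m1 r.
have Gnd : nondecreasing G.
  move=> a b ab; rewrite /G -subr_ge0 opprB addrACA -opprB opprK.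
  rewrite (_ : _ + _ = (distribution_function m2 b - distribution_function m2 a) -
    (distribution_function m1 b - distribution_function m1 a)); last by ring.
  by rewrite !distribution_functionB// subr_ge0 fine_le ?fin_num_measure ?m12.
have Grc : right_continuous G.
  by move=> a; apply: cvgB; exact: distribution_function_right_continuous.
pose Gc : cumulative R R := HB.pack G (isCumulative.Build R _ R G Gnd Grc).
have F2nd : nondecreasing (distribution_function m2).
  by move=> a b ab; rewrite -subr_ge0 distribution_functionB// fine_ge0.
pose F2c : cumulative R R := HB.pack (distribution_function m2)
  (isCumulative.Build R _ R (distribution_function m2) F2nd
    (@distribution_function_right_continuous m2)).
move=> A mA.
(* A Lebesgue-Stieltjes measure is determined by its values on half-open intervals, so this
   identification and the next are checked only there. *)
have <- : lebesgue_stieltjes_measure F2c A = m2 A.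
  apply: lebesgue_stieltjes_measure_unique => // _ [[a b] _ <-] /=.
  have [ab|ba] := leP a b; last by rewrite set_itv_ge ?measure0// bnd_simp -leNgt ltW.
  by rewrite lebesgue_stieltjes_ocitv// distribution_functionB// fineK ?fin_num_measure.
have -> : lebesgue_stieltjes_measure F2c A =
    measure_add m1 (lebesgue_stieltjes_measure Gc) A.
  apply: lebesgue_stieltjes_measure_unique => // _ [[a b] _ <-] /=.
  have [ab|ba] := leP a b; last by rewrite set_itv_ge ?measure0// bnd_simp -leNgt ltW.
  transitivity (m1 `]a, b]%classic + lebesgue_stieltjes_measure Gc `]a, b]%classic)%E;
    last by rewrite -measure_addE.
  rewrite !lebesgue_stieltjes_ocitv//.
  rewrite -[X in (X + _)%E]fineK ?fin_num_measure// -distribution_functionB//.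
  by rewrite -EFinD; congr EFin; rewrite /= /G; ring.
by rewrite measure_addE leeDl.
Qed.

End domination.

(** * Domination by a multiple of a measure gives a bounded density *)

Section bounded_density.
Context d (T : measurableType d) (R : realType).
Variables (nu mu : {finite_measure set T -> \bar R}) (C : R).
Hypothesis C0 : 0 <= C.
Hypothesis nuC : forall A, measurable A -> (nu A <= C%:E * mu A)%E.

(** The Radon-Nikodym derivative [h] exceeds [C] only on a null set; truncating it at [C] gives the
    bounds at every point without changing integrals. *)
Lemma bounded_density : exists w : T -> R,
  [/\ measurable_fun setT w, forall t, 0 <= w t <= C &
   forall f : T -> R, nu.-integrable setT (EFin \o f) ->
     (\int[nu]_t (f t)%:E = \int[mu]_t (f t * w t)%:E)%E].
Proof.
have numu : nu `<< mu.
  apply/null_content_dominatesP => A mA muA; apply/eqP.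
  by rewrite -measure_le0 (le_trans (nuC mA))// muA mule0.
pose h := Radon_Nikodym_SigmaFinite.f nu mu.
have h0 := Radon_Nikodym_SigmaFinite.f_ge0 numu.
have hfin := Radon_Nikodym_SigmaFinite.f_fin_num numu.
have inth := Radon_Nikodym_SigmaFinite.f_integrable numu.
have hE := Radon_Nikodym_SigmaFinite.f_integral numu.
rewrite -/h in h0 hfin inth hE.
have mh : measurable_fun setT h := measurable_int _ inth.
pose w t := Num.min C (fine (h t)).
have mw : measurable_fun setT w.
  by apply: measurable_minr => //; exact: (measurableT_comp (fine_measurable _)).
pose P := [set t | (C%:E < h t)%E].
have mP : measurable P.
  by rewrite -[P]setTI; exact: emeasurable_fun_o_infty.
have P0 : mu P = 0%E.
  have intC : mu.-integrable P (cst C%:E) by exact: finite_measure_integrable_cst.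
  have inthP : mu.-integrable P h by exact: integrableS inth.
  (* On [P] the function [h - C] is positive, yet its integral is [nu P - C * mu P <= 0]; hence it
     vanishes almost everywhere on [P], and [P] is null. *)
  have : ae_eq mu P (fun t => h t - C%:E)%E (cst 0%E).
    apply/ae_eq_integral_abs => //.
      by apply: emeasurable_funB => //; exact: measurable_funTS.
    apply/eqP; rewrite eq_le integral_ge0// andbT.
    rewrite (eq_integral (fun t => h t - C%:E)%E); last first.
      by move=> t /set_mem Pt; rewrite gee0_abs// sube_ge0// ltW.
    rewrite integralB// -hE// integral_cst// sube_le0.
    exact: nuC.
  move=> [N [mN N0 PN]]; apply/eqP; rewrite -measure_le0 -N0.
  apply: le_measure; rewrite ?inE// => t Pt; apply: PN => /= /(_ Pt) ht.
  by move: Pt; rewrite /P/= -sube_gt0 ht ltxx.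
have hw : ae_eq mu setT h (EFin \o w).
  exists P; split => // t /=; apply: contra_notP => nP _.
  rewrite /w -[LHS]fineK//; congr EFin; apply/esym/min_idPr.
  by rewrite -lee_fin fineK// leNgt; apply/negP.
exists w; split=> //.
  by move=> t; rewrite /w le_min C0 fine_ge0//= ge_min lexx.
move=> f intf; rewrite -(Radon_Nikodym_change_of_variables numu measurableT intf).
have mf := measurable_int _ intf.
apply: ae_eq_integral => //.
- by apply: emeasurable_funM => //.
- by apply/measurable_EFinP; apply: measurable_funM => //; exact/measurable_EFinP.
- have h1 := ae_eq_trans (ae_eq_sym (ae_eq_Radon_Nikodym_SigmaFinite numu measurableT)) hw.
  have := ae_eqe_mul2l (EFin \o f) h1.
  by [].
Qed.

End bounded_density.

(** * Scaling of Lebesgue measure and volume of spherical shells *)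

(** The rescaled image measure has the right value on rectangles, so uniqueness of the product
    measure applies. Used twice, it lifts the scaling law from the line to space. *)
Lemma product_measure_dilation {d1 d2} {T1 : measurableType d1} {T2 : measurableType d2}
    {R : realType} (m1 : {sigma_finite_measure set T1 -> \bar R})
    (m2 : {sigma_finite_measure set T2 -> \bar R}) (f1 : T1 -> T1) (f2 : T2 -> T2)
    (k1 k2 : R) : 0 <= k1 -> 0 <= k2 ->
  measurable_fun setT f1 -> measurable_fun setT f2 ->
  (forall E, measurable E -> k1%:E * m1 (f1 @^-1` E) = m1 E)%E ->
  (forall E, measurable E -> k2%:E * m2 (f2 @^-1` E) = m2 E)%E ->
  forall E, measurable E ->
  ((k1 * k2)%:E * (m1 \x m2) ((fun z => (f1 z.1, f2 z.2)) @^-1` E) = (m1 \x m2) E)%E.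
Proof.
move=> k10 k20 mf1 mf2 H1 H2 E mE.
pose F (z : T1 * T2) := (f1 z.1, f2 z.2).
have mF : measurable_fun setT F.
  apply/measurable_fun_pairP; split.
    exact: (measurableT_comp mf1 measurable_fst).
  exact: (measurableT_comp mf2 measurable_snd).
pose pm := mscale (NngNum (mulr_ge0 k10 k20)) (pushforward (m1 \x m2)%E F).
pose m := pm mF.
suff mU : (m1 \x m2)%E E = m E by rewrite mU.
apply: product_measure_unique => // A B mA mB.
transitivity ((k1 * k2)%:E * (m1 \x m2) ((f1 @^-1` A) `*` (f2 @^-1` B)))%E => //.
rewrite product_measure1E; [|by rewrite -[X in measurable X]setTI; exact: mf1
  |by rewrite -[X in measurable X]setTI; exact: mf2].
by rewrite EFinM muleACA H1// H2.
Qed.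

Section shells.
Variable R : realType.
Implicit Types (x y z : pt R) (D : set (pt R)).

Definition dilate (c k z : R) : R := c + k * (z - c).

Lemma continuous_dilate c k : continuous (dilate c k).
Proof.
move=> z; apply: cvgD; first exact: cvg_cst.
by apply: cvgMl_tmp; apply: cvgB; [exact: cvg_id|exact: cvg_cst].
Qed.

Lemma measurable_dilate c k : measurable_fun setT (dilate c k).
Proof. by apply: continuous_measurable_fun; exact: continuous_dilate. Qed.

(** By uniqueness of Lebesgue measure it suffices to treat []a, b]], whose preimage is an interval
    of length [(b - a) / k]. *)
Lemma lam_dilate (c k : R) : 0 < k -> forall E, measurable E ->
  (k%:E * lam (dilate c k @^-1` E) = lam E)%E.
Proof.
move=> k0 E mE.
have mf : measurable_fun setT (dilate c k : measurableTypeR R -> measurableTypeR R).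
  exact: measurable_dilate.
pose pm := mscale (NngNum (ltW k0)) (pushforward (@lebesgue_measure R)
  (dilate c k : measurableTypeR R -> measurableTypeR R)).
pose m := pm mf.
suff mU : @lebesgue_measure R E = m E by rewrite [RHS]mU.
apply: lebesgue_measure_unique => // _ [[a b] _ <-].
rewrite -[RHS]/(k%:E * lebesgue_measure (dilate c k @^-1` `]a, b]%classic))%E.
have -> : dilate c k @^-1` `]a, b] = `]c + (a - c) / k, c + (b - c) / k]%classic.
  apply/funext => u; apply/propext; rewrite /dilate/= !in_itv/=.
  have -> : (a < c + k * (u - c)) = (c + (a - c) / k < u).
    by rewrite -ltrBlDl -[RHS]ltrBrDl ltr_pdivrMr// mulrC.
  have -> : (c + k * (u - c) <= b) = (u <= c + (b - c) / k).
    by rewrite -[LHS]lerBrDl -[RHS]lerBlDl ler_pdivlMr// mulrC.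
  by [].
rewrite !lebesgue_measure_itv/= !lte_fin ltrD2l ltr_pM2r ?invr_gt0// ltrD2r.
case: ifPn => // _; last by rewrite mule0.
rewrite -!EFinD -EFinM; congr EFin; field.
by rewrite gt_eqF.
Qed.

Definition dilate3 x k z : pt R :=
  (dilate x.1.1 k z.1.1, dilate x.1.2 k z.1.2, dilate x.2 k z.2).

Lemma leb3_dilate3 x k E : 0 < k -> measurable E ->
  ((k ^+ 3)%:E * leb3 (dilate3 x k @^-1` E) = leb3 E)%E.
Proof.
move=> k0 mE.
have H1 := lam_dilate x.1.1 k0; have H2 := lam_dilate x.1.2 k0; have H3 := lam_dilate x.2 k0.
have m1 := measurable_dilate x.1.1 k; have m2 := measurable_dilate x.1.2 k.
have m3 := measurable_dilate x.2 k.
have k0' := ltW k0.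
have H12 := product_measure_dilation k0' k0' m1 m2 H1 H2.
have m12 : measurable_fun setT (fun z : R * R => (dilate x.1.1 k z.1, dilate x.1.2 k z.2)).
  apply/measurable_fun_pairP; split.
    exact: (measurableT_comp m1 measurable_fst).
  exact: (measurableT_comp m2 measurable_snd).
have m123 : measurable_fun setT (dilate3 x k).
  apply/measurable_fun_pairP; split.
    exact: (measurableT_comp m12 measurable_fst).
  exact: (measurableT_comp m3 measurable_snd).
rewrite !leb3E//; last by rewrite -[X in measurable X]setTI; exact: m123.
rewrite -[RHS](@product_measure_dilation _ _ _ _ _ (@lam2 R) (@lam R) _ _
  (k * k) k (mulr_ge0 k0' k0') k0' m12 m3 H12 H3 E mE).
by rewrite !exprS expr0 mulr1 mulrA.
Qed.

Lemma dist3_dilate3 x k z : 0 <= k -> dist3 x (dilate3 x k z) = k * dist3 x z.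
Proof.
move=> k0; rewrite /dist3 /dilate3 /dilate/=.
rewrite -[in RHS](ger0_norm k0) -[in RHS]sqrtr_sqr -sqrtrM ?sqr_ge0//.
by congr Num.sqrt; ring.
Qed.

(** Closed balls are used so that the shell over []s, t]] is exactly a difference of two of them. *)
Definition cball3 x (r : R) : set (pt R) := [set z | dist3 x z <= r].

Lemma measurable_dist3_preimage x (E : set R) : measurable E ->
  measurable (dist3 x @^-1` E).
Proof. by move=> mE; rewrite -[X in measurable X]setTI; exact: measurable_dist3. Qed.

Lemma measurable_cball3 x r : measurable (cball3 x r).
Proof.
rewrite (_ : cball3 x r = dist3 x @^-1` `]-oo, r]); first exact: measurable_dist3_preimage.
by apply/seteqP; split => z /=; rewrite in_itv.
Qed.

Lemma leb3_cball3_lty x r : (leb3 (cball3 x r) < +oo)%E.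
Proof.
apply: le_lt_trans (leb3_ball3_lty x (r + 1)); apply: le_measure; rewrite ?inE//.
- exact: measurable_cball3.
- exact: open_measurable3 (@open_ball3 _ _ _).
- by move=> z; rewrite /cball3 /ball3/= => zr; rewrite (le_lt_trans zr)// ltrDl.
Qed.

(** The ball of radius [r] is the preimage of the unit ball under the homothety of ratio [1 / r]
    about [x]. *)
Lemma leb3_cball3 x r : 0 < r ->
  leb3 (cball3 x r) = ((r ^+ 3)%:E * leb3 (cball3 x 1))%E.
Proof.
move=> r0; have ri0 : 0 < r^-1 by rewrite invr_gt0.
rewrite -(leb3_dilate3 x ri0 (measurable_cball3 x 1)).
have -> : dilate3 x r^-1 @^-1` cball3 x 1 = cball3 x r.
  apply/seteqP; split => z; rewrite /cball3/= dist3_dilate3 ?(ltW ri0)//.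
    by rewrite mulrC ler_pdivrMr// mul1r.
  by rewrite mulrC ler_pdivrMr// mul1r.
by rewrite muleA -EFinM -exprMn divff ?gt_eqF// expr1n mul1e.
Qed.

(** The volume is that of the unit ball times [t^3 - s^3], and [t^3 - s^3 <= 3 t^2 (t - s)]. *)
Lemma leb3_shell_le x : exists2 V : R, 0 <= V & forall s t : R, 0 < s -> s <= t ->
  (leb3 (dist3 x @^-1` `]s, t]) <= (V * t ^+ 2 * (t - s))%:E)%E.
Proof.
have Vfin : leb3 (cball3 x 1) \is a fin_num.
  by rewrite ge0_fin_numE// leb3_cball3_lty.
exists (3 * fine (leb3 (cball3 x 1))); first by rewrite mulr_ge0// fine_ge0.
move=> s t s0 st.
have -> : dist3 x @^-1` `]s, t] = cball3 x t `\` cball3 x s.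
  apply/seteqP; split => z; rewrite /cball3/= in_itv/=.
    by move=> /andP[sz zt]; split => //; apply/negP; rewrite -ltNge.
  by move=> [-> /negP]; rewrite -ltNge => ->.
have mt := measurable_cball3 x t; have ms := measurable_cball3 x s.
have -> : leb3 (cball3 x t `\` cball3 x s) = (leb3 (cball3 x t) - leb3 (cball3 x s))%E.
  rewrite measureD//; last exact: leb3_cball3_lty.
  by rewrite setIidr// => z; rewrite /cball3/= => /le_trans; apply.
rewrite (leb3_cball3 x s0) (leb3_cball3 x (lt_le_trans s0 st)).
rewrite -(fineK Vfin) -!EFinM -EFinB lee_fin -mulrBl.
set V := fine _; have V0 : 0 <= V by rewrite fine_ge0.
rewrite (_ : 3 * V * t ^+ 2 * (t - s) = (3 * t ^+ 2 * (t - s)) * V); last by ring.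
apply: ler_wpM2r => //; rewrite -subr_ge0.
rewrite (_ : _ - _ = (t - s) ^+ 2 * (2 * t + s)); last by ring.
by rewrite mulr_ge0 ?sqr_ge0// addr_ge0 ?mulr_ge0 ?(ltW s0)// (le_trans (ltW s0)).
Qed.

End shells.

(** * Lower bound for the volume of thin shells inside an open set *)

Section shell_lower_bound.
Variable R : realType.
Implicit Types (x y z p : pt R) (D : set (pt R)).

Definition horizontal2 x p : R := (x.1.1 - p.1.1) ^+ 2 + (x.1.2 - p.1.2) ^+ 2.

(* Inverse of the chart [z |-> (z.1, dist3 x z)] on the half space of sign [sg];
   outside the domain of the chart the square root is [0]. *)
Definition sphere_chart x (sg : R) p : pt R :=
  (p.1.1, p.1.2, x.2 + sg * Num.sqrt (p.2 ^+ 2 - horizontal2 x p)).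

Lemma horizontal2_ge0 x p : 0 <= horizontal2 x p.
Proof. by rewrite addr_ge0 ?sqr_ge0. Qed.

Lemma continuous_horizontal2 x : continuous (horizontal2 x).
Proof.
move=> p; have sq (a : R) (f : pt R -> R) : {for p, continuous f} ->
    {for p, continuous (fun z => (a - f z) ^+ 2)}.
  move=> cf; apply: (@continuous_comp _ _ _ (fun z => a - f z) (fun t => t ^+ 2));
    last exact: exprn_continuous.
  by apply: cvgB => //; exact: cvg_cst.
apply: cvgD; apply: sq.
  by apply: continuous_comp; [exact: cvg_fst|exact: cvg_fst].
by apply: continuous_comp; [exact: cvg_fst|exact: cvg_snd].
Qed.

Lemma continuous_discriminant x : continuous (fun p => p.2 ^+ 2 - horizontal2 x p).
Proof.
move=> p; apply: cvgB; last exact: continuous_horizontal2.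
apply: (@continuous_comp _ _ _ (fun p : pt R => p.2) (fun t => t ^+ 2));
  last exact: exprn_continuous.
exact: cvg_snd.
Qed.

Lemma continuous_sphere_chart x sg : continuous (sphere_chart x sg).
Proof.
apply: continuous_pair; first apply: continuous_pair.
- by move=> p; apply: continuous_comp; [exact: cvg_fst|exact: cvg_fst].
- by move=> p; apply: continuous_comp; [exact: cvg_fst|exact: cvg_snd].
move=> p; apply: cvgD; first exact: cvg_cst.
apply: cvgMl_tmp; apply: (@continuous_comp _ _ _ (fun p : pt R => p.2 ^+ 2 - horizontal2 x p)).
  exact: continuous_discriminant.
exact: sqrt_continuous.
Qed.

Lemma dist3_horizontal2 x z :
  dist3 x z = Num.sqrt (horizontal2 x z + (x.2 - z.2) ^+ 2).
Proof. by []. Qed.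

(* Radial derivatives of the height [sqrt (r ^ 2 - h)] are at least [1]. *)
Lemma sqrt_sub_expansive (h s t : R) : 0 <= h -> 0 <= s -> s <= t -> h <= s ^+ 2 ->
  t - s <= Num.sqrt (t ^+ 2 - h) - Num.sqrt (s ^+ 2 - h).
Proof.
move=> h0 s0 st hs; have t0 : 0 <= t by exact: le_trans st.
have st2 : s ^+ 2 <= t ^+ 2 by rewrite lerXn2r.
set A := Num.sqrt (t ^+ 2 - h); set B := Num.sqrt (s ^+ 2 - h).
have A2 : A ^+ 2 = t ^+ 2 - h by rewrite sqr_sqrtr// subr_ge0 (le_trans hs).
have B2 : B ^+ 2 = s ^+ 2 - h by rewrite sqr_sqrtr// subr_ge0.
have A0 : 0 <= A := sqrtr_ge0 _; have B0 : 0 <= B := sqrtr_ge0 _.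
have At : A <= t.
  by rewrite -(ger0_norm t0) -sqrtr_sqr ler_wsqrtr// gerBl.
have Bs : B <= s.
  by rewrite -(ger0_norm s0) -sqrtr_sqr ler_wsqrtr// gerBl.
have AB : B <= A by rewrite ler_wsqrtr// lerD2r.
have [ts0|ts0] := eqVneq (t + s) 0.
  by rewrite (_ : t - s = 0) ?subr_ge0//; lra.
have ts : 0 < t + s by rewrite lt_def ts0 addr_ge0.
rewrite -(ler_pM2r ts).
(* Both products equal [t^2 - s^2], and [A + B <= t + s] forces the reverse inequality for the
   differences. *)
have -> : (t - s) * (t + s) = (A - B) * (A + B).
  by transitivity (t ^+ 2 - s ^+ 2); [ring|transitivity (A ^+ 2 - B ^+ 2); [rewrite A2 B2; ring|ring]].
by apply: ler_wpM2l; [rewrite subr_ge0|exact: lerD].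
Qed.

Lemma lam_height_interval (c sg a b : R) : sg = 1 \/ sg = -1 -> a <= b ->
  lam [set u | a < sg * (u - c) < b] = (b - a)%:E.
Proof.
move=> sg1 ab.
have itv (s t : R) : s <= t -> lam `]s, t[%classic = (t - s)%:E.
  move=> st; rewrite /lam [LHS](@lebesgue_measure_itv R `]s, t[)/= lte_fin.
  case: ifPn => // st'; congr EFin.
  by apply/eqP; rewrite eq_sym subr_eq0 eq_le st leNgt st'.
case: sg1 => ->.
  rewrite (_ : mkset _ = `]c + a, c + b[%classic); last first.
    by apply/funext => u; apply/propext; rewrite /= in_itv/= mul1r ltrBrDl ltrBlDl.
  by rewrite itv ?lerD2l//; congr EFin; ring.
rewrite (_ : mkset _ = `]c - b, c - a[%classic); last first.
  apply/funext => u; apply/propext; rewrite /= in_itv/= mulN1r opprB.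
  by rewrite ltrBlDr -ltrBlDl ltrBrDl -ltrBrDr andbC.
by rewrite itv ?lerD2l ?lerN2//; congr EFin; ring.
Qed.

(* On the equator the chart degenerates, so the base point is first moved off it along
   the sphere. *)
Lemma sphere_chart_box D x z : open D -> D z -> 0 < dist3 x z ->
  exists sg c1 c2 e, [/\ sg = 1 \/ sg = -1, 0 < e, e < dist3 x z &
    box3 (c1, c2, dist3 x z) e `<=` [set p | D (sphere_chart x sg p) /\
      0 < p.2 ^+ 2 - horizontal2 x p]].
Proof.
move=> oD Dz; set r := dist3 x z => r0.
have r2 : r ^+ 2 = horizontal2 x z + (x.2 - z.2) ^+ 2.
  by rewrite /r dist3_horizontal2 sqr_sqrtr// addr_ge0 ?horizontal2_ge0 ?sqr_ge0.
pose sg : R := if x.2 <= z.2 then 1 else -1.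
have sg1 : sg = 1 \/ sg = -1 by rewrite /sg; case: ifP; [left|right].
have zE : sphere_chart x sg (z.1, r) = z.
  rewrite /sphere_chart/= r2 addrAC subrr add0r sqrtr_sqr /sg.
  case: ifPn => [xz|/negP/negP]; last rewrite -ltNge => xz.
    by rewrite mul1r distrC ger0_norm ?subr_ge0// subrKC; case: (z) => [[]].
  by rewrite mulN1r gtr0_norm ?subr_gt0// opprB subrKC; case: (z) => [[]].
(* Contracting the horizontal coordinates towards [x] at fixed radius makes the discriminant
   positive once [k < 1]; for [k] near [1] the point stays in [D]. *)
pose base (k : R) : pt R := (dilate x.1.1 k z.1.1, dilate x.1.2 k z.1.2, r).
have cdil (c u : R) : continuous (fun k => dilate c k u).
  by move=> k; apply: cvgD; [exact: cvg_cst|apply: cvgMr_tmp; exact: cvg_id].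
have cbase : continuous base.
  by do 2 ?apply: continuous_pair; [exact: cdil|exact: cdil|move=> k; exact: cvg_cst].
have base1 : base 1 = (z.1, r).
  by rewrite /base /dilate !mul1r !subrKC; case: (z.1).
have : nbhs (1 : R) ((sphere_chart x sg \o base) @^-1` D).
  apply: (continuous_comp (cbase 1) (@continuous_sphere_chart x sg (base 1))).
  by rewrite /= base1 zE; exact: open_nbhs_nbhs.
move=> /nbhs_ballP[d /= d0 Hd].
pose k := 1 - Num.min d 1 / 2.
have m0 : 0 < Num.min d 1 by rewrite lt_min d0 ltr01.
have m1 : Num.min d 1 <= 1 by rewrite ge_min lexx orbT.
have md : Num.min d 1 <= d by rewrite ge_min lexx.
have k0 : 0 < k by rewrite /k; lra.
have k1 : k < 1 by rewrite /k; lra.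
have Dk : D (sphere_chart x sg (base k)).
  by apply: Hd; rewrite /ball/= /k opprB subrKC gtr0_norm; lra.
have disc : 0 < (base k).2 ^+ 2 - horizontal2 x (base k).
  rewrite /= /horizontal2/= /dilate.
  have -> : (x.1.1 - (x.1.1 + k * (z.1.1 - x.1.1))) ^+ 2 +
      (x.1.2 - (x.1.2 + k * (z.1.2 - x.1.2))) ^+ 2 = k ^+ 2 * horizontal2 x z.
    by rewrite /horizontal2; ring.
  have kk : k ^+ 2 < 1 by rewrite expr_lt1 ?ltW.
  have hr : horizontal2 x z <= r ^+ 2 by rewrite r2 lerDl sqr_ge0.
  have r20 : 0 < r ^+ 2 by rewrite exprn_gt0.
  rewrite subr_gt0 (@le_lt_trans _ _ (k ^+ 2 * r ^+ 2))//.
    by apply: ler_wpM2l => //; exact: sqr_ge0.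
  by rewrite gtr_pMl.
have : nbhs (base k) [set p | D (sphere_chart x sg p) /\ 0 < p.2 ^+ 2 - horizontal2 x p].
  apply: filterI.
    by apply: (@continuous_sphere_chart x sg (base k)); exact: open_nbhs_nbhs.
  apply: (@continuous_discriminant x (base k) [set u | 0 < u]).
  by apply: open_nbhs_nbhs; split; [exact: open_gt|].
move=> /nbhs_box3[e e0 He].
(* The cap [r / 2] keeps the admissible radii away from [0]. *)
have er : 0 < Num.min e (r / 2) by rewrite lt_min e0 divr_gt0.
exists sg, (dilate x.1.1 k z.1.1), (dilate x.1.2 k z.1.2), (Num.min e (r / 2)); split => //.
  have : Num.min e (r / 2) <= r / 2 by rewrite ge_min lexx orbT.
  by move=> h; apply: (le_lt_trans h); lra.
have me : Num.min e (r / 2) <= e by rewrite ge_min lexx.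
move=> p [[h1 h2] h3]; apply: He.
by split; [split|]; [exact: le_ball h1|exact: le_ball h2|exact: le_ball h3].
Qed.

(** Over each horizontal point of a square [Q] of side [2 e], the part of [D] in the shell contains
    the heights swept by the chart between radii [s] and [t]. By [sqrt_sub_expansive] these have
    length at least [t - s]; Fubini then yields the constant [(2 e)^2], the area of [Q]. *)
Lemma leb3_shell_ge D x z : open D -> D z -> 0 < dist3 x z ->
  exists e c : R, [/\ 0 < e, e < dist3 x z, 0 < c & forall s t : R,
    dist3 x z - e < s -> s <= t -> t < dist3 x z + e ->
    ((c * (t - s))%:E <= leb3 (D `&` dist3 x @^-1` `]s, t]))%E].
Proof.
move=> oD Dz r0.
have [sg [c1 [c2 [e [sg1 e0 er He]]]]] := sphere_chart_box oD Dz r0.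
set r := dist3 x z in r0 er He *.
exists e, ((e *+ 2) ^+ 2); split=> // [|s t rs st tr].
  by rewrite exprn_gt0// mulrn_wgt0.
set E := D `&` _.
have mE : measurable E.
  by apply: measurableI; [exact: open_measurable3|exact: measurable_dist3_preimage].
pose Q : set (R * R) := ball c1 e `*` ball c2 e.
have mQ : measurable Q by apply: measurableX; exact: measurable_ball.
have sgsg : sg * sg = 1 by case: sg1 => ->; ring.
have s0 : 0 < s by lra.
have Qbox (p : R * R) (u : R) : Q p -> r - e < u < r + e -> box3 (c1, c2, r) e (p, u).
  by move=> [h1 h2] /andP[u1 u2]; split; [split|] => //=; rewrite /ball/= distrC ltr_distl u1 u2.
have section_ge (p : R * R) : Q p -> ((t - s)%:E <= lam (xsection E p))%E.
  case: p => p1 p2 Qp; set p := (p1, p2) in Qp *; set h := horizontal2 x (p, 0).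
  have disc u : r - e < u < r + e -> 0 < u ^+ 2 - h.
    by move=> /(Qbox _ _ Qp)/He[].
  have chart u : r - e < u < r + e -> D (p, x.2 + sg * Num.sqrt (u ^+ 2 - h)).
    by move=> /(Qbox _ _ Qp)/He[].
  have hs : 0 < s ^+ 2 - h by apply: disc; apply/andP; split; lra.
  have h0 : 0 <= h := horizontal2_ge0 _ _.
  have exp := sqrt_sub_expansive h0 (ltW s0) st (_ : h <= s ^+ 2).
  have {exp}exp := exp (ltW _); rewrite -subr_gt0 in exp; have {}exp := exp hs.
  apply: (@le_trans _ _ (lam [set u | Num.sqrt (s ^+ 2 - h) < sg * (u - x.2) < Num.sqrt (t ^+ 2 - h)])).
    by rewrite lam_height_interval ?lee_fin// -subr_ge0 (le_trans _ exp)// subr_ge0.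
  apply: le_measure; rewrite ?inE.
  - have [sgE|sgE] := sg1.
      rewrite (_ : mkset _ = `]x.2 + Num.sqrt (s ^+ 2 - h), x.2 + Num.sqrt (t ^+ 2 - h)[%classic)//.
      by apply/funext => u; apply/propext; rewrite /= in_itv/= sgE mul1r ltrBrDl ltrBlDl.
    rewrite (_ : mkset _ = `]x.2 - Num.sqrt (t ^+ 2 - h), x.2 - Num.sqrt (s ^+ 2 - h)[%classic)//.
    apply/funext => u; apply/propext; rewrite /= in_itv/= sgE mulN1r opprB.
    by rewrite ltrBlDr -ltrBlDl ltrBrDl -ltrBrDr andbC.
  - exact: measurable_xsection.
  move=> u /= /andP[su ut]; rewrite /xsection/= inE.
  set w := sg * (u - x.2) in su ut.
  have w0 : 0 < w by exact: le_lt_trans (sqrtr_ge0 _) su.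
  have uE : u = x.2 + sg * w by rewrite /w mulrA sgsg mul1r subrKC.
  have t2h : 0 <= t ^+ 2 - h.
    by rewrite (le_trans (ltW hs))// lerD2r lerXn2r// ?nnegrE ltW// (lt_le_trans s0).
  have sw : s ^+ 2 - h < w ^+ 2.
    rewrite -[ltLHS](sqr_sqrtr (ltW hs)) ltrXn2r// ?nnegrE ?sqrtr_ge0// ltW//.
  have wt : w ^+ 2 < t ^+ 2 - h.
    by rewrite -[ltRHS](sqr_sqrtr t2h) ltrXn2r// ?nnegrE ?sqrtr_ge0// ltW.
  (* [v] is the distance from [x] to [(p, u)]. It lies in []s, t[], and the chart at radius [v]
     returns this very point, which is therefore in [D]. *)
  pose v := Num.sqrt (h + w ^+ 2).
  have v2 : v ^+ 2 = h + w ^+ 2 by rewrite sqr_sqrtr// addr_ge0// sqr_ge0.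
  have v0 : 0 <= v := sqrtr_ge0 _.
  have sv : s < v by rewrite -(@ltr_pXn2r _ 2)// ?nnegrE ?(ltW s0)// v2; lra.
  have vt : v < t.
    by rewrite -(@ltr_pXn2r _ 2)// ?nnegrE ?(le_trans (ltW s0) st)// v2; lra.
  have vr : r - e < v < r + e by apply/andP; split; lra.
  have dv : dist3 x (p, u) = v.
    rewrite dist3_horizontal2 /v /w; congr (Num.sqrt (_ + _)).
    by rewrite exprMn [sg ^+ 2]expr2 sgsg mul1r/= -sqrrN opprB.
  split; last by rewrite /= in_itv/= dv sv ltW.
  have := chart v vr; rewrite v2 addrAC subrr add0r sqrtr_sqr gtr0_norm//.
  by rewrite -uE.
rewrite leb3E// -[leRHS]/(\int[lam2]_p (lam \o xsection E) p)%E.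
apply: (@le_trans _ _ (\int[lam2]_(p in Q) (lam \o xsection E) p)%E); last first.
  apply: ge0_subset_integral => //.
  exact: (measurable_fun_xsection (@lam R) mE).
apply: (@le_trans _ _ (\int[lam2]_(p in Q) (cst (t - s)%:E) p)%E).
  rewrite integral_cst// -[X in (_ <= _ * X)%E]/((lam \x lam) Q)%E product_measure1E//;
    [|exact: measurable_ball..].
  rewrite [X in (_ <= _ * (X * _))%E](lebesgue_measure_ball _ (ltW e0)).
  rewrite [X in (_ <= _ * (_ * X))%E](lebesgue_measure_ball _ (ltW e0)).
  by rewrite -!EFinM lee_fin mulrC expr2.
apply: ge0_le_integral => //.
- by move=> p _; rewrite lee_fin subr_ge0.
- apply: measurable_funTS; exact: (measurable_fun_xsection (@lam R) mE).
Qed.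

End shell_lower_bound.

(** * Image measures and the transfer of integrals from one set to another *)

Section image_measure.
Context d (T : measurableType d) (R : realType) (mu : {measure set T -> \bar R}).
Variables (A : set T) (rho : T -> R).

(** The proofs are arguments so that each instance of this set function can carry its finite measure
    structure. *)
Definition image_on (mA : measurable A) (muA : (mu A < +oo)%E)
    (mrho : measurable_fun setT rho) : set (measurableTypeR R) -> \bar R :=
  fun E => mu (rho @^-1` E `&` A).

Hypotheses (mA : measurable A) (muA : (mu A < +oo)%E) (mrho : measurable_fun setT rho).
Local Notation image := (image_on mA muA mrho).

Let mrho' : measurable_fun setT (rho : T -> measurableTypeR R) := mrho.
Let P : {measure set (measurableTypeR R) -> \bar R} :=
  measure_function_pushforward__canonical__measure_function_Measure (mrestr mu mA) mrho'.

HB.instance Definition _ := isMeasure.Build _ _ _ image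
  (measure0 P) (measure_ge0 P) (@measure_semi_sigma_additive _ _ _ P).

Let image_fin : fin_num_fun image.
Proof.
move=> E mE; rewrite ge0_fin_numE; last exact: measure_ge0.
apply: le_lt_trans muA; apply: le_measure; rewrite ?inE//.
by apply: measurableI => //; rewrite -[X in measurable X]setTI; exact: mrho'.
Qed.

HB.instance Definition _ := Measure_isFinite.Build _ _ _ image image_fin.

Lemma integral_image_on (f : R -> R) (C : R) : measurable_fun setT f ->
  (forall r, `|f r| <= C) ->
  (\int[image]_r (f r)%:E = \int[mu]_(t in A) (f (rho t))%:E)%E.
Proof.
move=> mf fC.
have mfr : measurable_fun setT (f \o rho) by exact: measurableT_comp.
have restrlty : (mrestr mu mA setT < +oo)%E by rewrite /mrestr setTI.
have int_restr : (mrestr mu mA).-integrable setT (EFin \o (f \o rho)).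
  by apply: (integrable_bounded_lty (C := C)) => // t _; exact: fC.
transitivity (\int[P]_r (f r)%:E)%E; first exact: eq_measure_integral.
transitivity (\int[mrestr mu mA]_t (f (rho t))%:E)%E.
  have mfE : measurable_fun setT (fun r : measurableTypeR R => (f r)%:E).
    exact/measurable_EFinP.
  exact: (@integral_pushforward _ _ _ _ _ _ mrho' _ setT _ mfE int_restr measurableT).
rewrite [LHS](@negligible_integral _ _ _ _ _ (~` A))//.
- rewrite setTD setCK; apply: eq_measure_integral => E mE EA.
  by rewrite /= /mrestr setIidl.
- exact: measurableC.
- by transitivity (mu (~` A `&` A)); [|rewrite setICl measure0].
Qed.

End image_measure.

Section transfer.
Context d (T : measurableType d) (R : realType) (mu : {measure set T -> \bar R}).
Variables (A1 A2 : set T) (rho : T -> R) (C : R).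
Hypotheses (mA1 : measurable A1) (mA2 : measurable A2).
Hypotheses (muA1 : (mu A1 < +oo)%E) (muA2 : (mu A2 < +oo)%E).
Hypotheses (mrho : measurable_fun setT rho) (C0 : 0 <= C).
Hypothesis A12 : forall s t : R, s <= t ->
  (mu (rho @^-1` `]s, t] `&` A1) <= C%:E * mu (rho @^-1` `]s, t] `&` A2))%E.

(** The bound on half-open intervals extends to all Borel sets by [le_measure_of_le_ocitv]. The
    image of [A1] then has a bounded density with respect to that of [A2], which is pulled back
    along [rho]. *)
Lemma transfer_density : exists w : R -> R,
  [/\ measurable_fun setT w, forall r, 0 <= w r <= C &
   forall (f : R -> R) (M : R), measurable_fun setT f -> (forall r, `|f r| <= M) ->
     (\int[mu]_(t in A1) (f (rho t))%:E = \int[mu]_(t in A2) (f (rho t) * w (rho t))%:E)%E].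
Proof.
pose nu1 : {finite_measure set (measurableTypeR R) -> \bar R} := image_on mA1 muA1 mrho.
pose nu2 : {finite_measure set (measurableTypeR R) -> \bar R} := image_on mA2 muA2 mrho.
pose nu2C : {finite_measure set (measurableTypeR R) -> \bar R} := mscale (NngNum C0) nu2.
have nu12 E : measurable E -> (nu1 E <= C%:E * nu2 E)%E.
  exact: (@le_measure_of_le_ocitv _ nu1 nu2C A12).
have [w [mw wC Hw]] := bounded_density C0 nu12.
exists w; split=> // f M mf fM.
rewrite -(integral_image_on mA1 muA1 mrho mf fM) Hw; last first.
  apply: (integrable_bounded_lty (C := M)) => //.
  by rewrite -ge0_fin_numE// fin_num_measure.
apply: (integral_image_on mA2 muA2 mrho (f := fun r => f r * w r) (C := M * C)).
  exact: measurable_funM.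
move=> r; rewrite normrM; apply: ler_pM => //.
by have /andP[w0 wC'] := wC r; rewrite ger0_norm.
Qed.

End transfer.

(** * Construction of a preimage *)

Section range_membership.
Variable R : realType.
Implicit Types (x y z : pt R) (D A : set (pt R)).

(** Fubini with the space integral inside, so that the ball can be exchanged for [D] at each fixed
    time. *)
Lemma Rintegral_lebST_X A (a b : R) (F : pt R * R -> R) (M : R) :
  measurable A -> (leb3 A < +oo)%E -> measurable_fun setT F -> (forall p, `|F p| <= M) ->
  (\int[@lebST R]_(p in A `*` `]a, b[) (F p)%:E =
   \int[lam]_(t in `]a, b[) \int[@leb3 R]_(z in A) (F (z, t))%:E)%E.
Proof.
move=> mA Alty mF FM.
have mAI : measurable (A `*` `]a, b[%classic) by exact: measurableX.
have intF : (@lebST R).-integrable (A `*` `]a, b[) (EFin \o F).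
  apply: (integrable_bounded_lty (C := M)) => //; first exact: lebST_X_lty.
  exact: measurable_funTS.
rewrite integral_mkcond [RHS]integral_mkcond.
have intF' : (@leb3 R \x @lam R)%E.-integrable setT ((EFin \o F) \_ (A `*` `]a, b[)).
  exact/(integrable_mkcond _ mAI).
apply: (etrans (esym (integral21_prod_meas1 intF'))).
apply: eq_integral => t _; rewrite /fubini_G patchE; case: ifPn => [tI|tI].
  rewrite [RHS]integral_mkcond; apply: eq_integral => z _; rewrite !patchE.
  have -> // : ((z, t) \in A `*` `]a, b[%classic) = (z \in A).
  apply/idP/idP => [/set_mem[zA _]|zA]; first exact: mem_set.
  by apply/mem_set; split; [exact: set_mem|exact: set_mem tI].
rewrite -[RHS](integral0 (@leb3 R) setT); apply: eq_integral => z _; rewrite patchE.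
by rewrite ifF//; apply/negbTE; apply: contra tI => /set_mem[_ tI]; exact: mem_set.
Qed.

(** The distances from [x] to points of the connected set [D] form an interval. *)
Lemma connected_dist3_value D x (r : R) : connected D -> D !=set0 ->
  inf (dist_set x D) < r < sup (dist_set x D) -> exists2 z, D z & dist3 x z = r.
Proof.
move=> cD [z0 Dz0] /andP[ir rs].
have D0 : dist_set x D !=set0 by exists (dist3 x z0), z0.
have [_ [z1 Dz1 <-] r1] := inf_lt D0 ir.
have [_ [z2 Dz2 <-] r2] := sup_gt D0 rs.
have : connected (dist3 x @` D).
  by apply: connected_continuous_connected => //; apply: continuous_subspaceT; exact: continuous_dist3.
move=> /connected_intervalP /(_ (dist3 x z1) (dist3 x z2)).
have [] := (@imageP _ _ (dist3 x) _ _ Dz1, @imageP _ _ (dist3 x) _ _ Dz2).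
move=> i1 i2 /(_ i1 i2 r); rewrite (ltW r1) (ltW r2) => /(_ isT)[z Dz zr].
by exists z.
Qed.

(** Some point of [D] is as far from [x] as [y]. Thin shells near that radius have volume at most a
    multiple of [t - s] in the whole space and at least a multiple of [t - s] within [D], and a
    small ball about [y] meets only such shells. *)
Lemma shell_comparison D x y : open D -> connected D -> D !=set0 -> bounded3 D ->
  annulus_D D x y -> exists eps0, 0 < eps0 /\ exists2 C : R, 0 <= C &
    forall eps, eps < eps0 -> forall s t : R, s <= t ->
    (leb3 (dist3 x @^-1` `]s, t] `&` ball3 y eps) <=
     C%:E * leb3 (dist3 x @^-1` `]s, t] `&` D))%E.
Proof.
move=> oD cD D0 bD yann.
have r0 : 0 < dist3 x y by move: yann => /andP[+ _]; apply: le_lt_trans; exact: inf_dist_set_ge0.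
have [z0 Dz0 z0y] := connected_dist3_value cD D0 yann.
rewrite -z0y in r0.
have [e [c [e0 er c0 low]]] := leb3_shell_ge oD Dz0 r0.
have [V V0 up] := leb3_shell_le x.
rewrite z0y in er low r0; set r := dist3 x y in er low r0.
have : nbhs y (dist3 x @^-1` ball r (e / 2)).
  by apply: continuous_dist3; apply: nbhsx_ballx; rewrite divr_gt0.
move=> /nbhs_box3[eps0 eps00 Heps].
exists eps0; split=> //.
have C0 : 0 <= V * (r + e) ^+ 2 / c by rewrite divr_ge0 ?(ltW c0)// mulr_ge0 ?sqr_ge0.
exists (V * (r + e) ^+ 2 / c) => // eps epsl s t st.
(* The shell is clipped to radii within [e / 2] of [r]: this loses nothing of the ball, keeps [s']
   positive and stays strictly inside the range of the lower bound. *)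
pose s' := Num.max s (r - e / 2); pose t' := Num.min t (r + e / 2).
have s's : s <= s' by rewrite le_max lexx.
have s'r : r - e / 2 <= s' by rewrite le_max lexx orbT.
have t't : t' <= t by rewrite ge_min lexx.
have t'r : t' <= r + e / 2 by rewrite ge_min lexx orbT.
have mb := open_measurable3 (@open_ball3 R y eps).
have mD := open_measurable3 oD.
have sub : dist3 x @^-1` `]s, t] `&` ball3 y eps `<=` dist3 x @^-1` `]s', t'].
  move=> z [/=]; rewrite !in_itv/= => /andP[sz zt] /ball3_sub_box3[[h1 h2] h3].
  have : box3 y eps0 z.
    by split; [split|]; [exact: le_ball (ltW epsl) _ h1|exact: le_ball (ltW epsl) _ h2|
      exact: le_ball (ltW epsl) _ h3].
  move=> /Heps; rewrite /ball/= ltr_norml => /andP[z1 z2].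
  by rewrite gt_max le_min sz zt/=; apply/andP; split; lra.
have [st'|ts'] := leP s' t'; last first.
  rewrite (_ : _ `&` ball3 y eps = set0) ?measure0 ?mule_ge0 ?lee_fin//.
  rewrite -subset0 => z /sub/=; rewrite in_itv/= => /andP[h1 h2].
  by have := lt_trans (lt_le_trans h1 h2) ts'; rewrite ltxx.
apply: (@le_trans _ _ (leb3 (dist3 x @^-1` `]s', t']))).
  apply: le_measure; rewrite ?inE//; last exact: measurable_dist3_preimage.
  by apply: measurableI => //; exact: measurable_dist3_preimage.
have s'0 : 0 < s' by lra.
apply: (le_trans (up s' t' s'0 st')).
apply: (@le_trans _ _ ((V * (r + e) ^+ 2 / c)%:E * (c * (t' - s'))%:E)%E).
  rewrite -EFinM lee_fin.
  have -> : V * (r + e) ^+ 2 / c * (c * (t' - s')) = V * (r + e) ^+ 2 * (t' - s').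
    by field; rewrite gt_eqF.
  apply: ler_wpM2r; first by rewrite subr_ge0.
  by apply: ler_wpM2l => //; rewrite lerXn2r// ?nnegrE; lra.
apply: lee_wpmul2l; first by rewrite lee_fin.
apply: (le_trans (low s' t' _ st' _)); [lra|lra|].
apply: le_measure; rewrite ?inE//.
- by apply: measurableI => //; exact: measurable_dist3_preimage.
- by apply: measurableI => //; exact: measurable_dist3_preimage.
move=> z [Dz /=]; rewrite !in_itv/= => /andP[h1 h2]; split => //.
by rewrite (le_lt_trans s's h1) (le_trans h2).
Qed.

Lemma in_range_LD_ball D x y (tmin tmax K eta eps C : R) : open D -> bounded3 D ->
  tmin < eta <= tmax -> 0 <= C ->
  (forall s t : R, s <= t ->
    (leb3 (dist3 x @^-1` `]s, t] `&` ball3 y eps) <=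
     C%:E * leb3 (dist3 x @^-1` `]s, t] `&` D))%E) ->
  in_range_LD D tmin tmax x K (phi_re tmin x y eta eps) (phi_im tmin x y eta eps).
Proof.
move=> oD bD /andP[te etm] C0 cmp.
have mD := open_measurable3 oD.
have mB := open_measurable3 (@open_ball3 R y eps).
have Dlty := bounded3_leb3_lty mD bD.
have Blty := leb3_ball3_lty y eps.
have [w [mw wC Hw]] := transfer_density mB mD Blty Dlty (@measurable_dist3 R x) C0 cmp.
have w0 r : 0 <= w r by have /andP[] := wC r.
have wC' r : w r <= C by have /andP[] := wC r.
pose k := phi_coef tmin y eta eps.
pose A := STdom D tmin tmax; pose A' := D `*` `]tmin, eta[.
have mA : measurable A by exact: measurableX.
have mA' : measurable A' by exact: measurableX.
have A'A : A' `<=` A.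
  move=> [z t] [/= Dz]; rewrite in_itv/= => /andP[t1 t2]; split => //=.
  by rewrite in_itv/= t1 (lt_le_trans t2).
have Alty : (lebST A < +oo)%E by exact: lebST_X_lty.
have A'lty : (lebST A' < +oo)%E by exact: lebST_X_lty.
have mrho1 : measurable_fun setT (fun p : pt R * R => dist3 x p.1).
  exact: (measurableT_comp (measurable_dist3 x) measurable_fst).
pose g (p : pt R * R) := k * w (dist3 x p.1).
have mg : measurable_fun setT g.
  by apply: measurable_funM => //; exact: (measurableT_comp mw mrho1).
have gM p : `|g p| <= `|k| * C by rewrite normrM ler_wpM2l// ger0_norm.
(* The preimage is real and is cut off at time [eta], which [eta <= tmax] allows. *)
pose ur := g \_ A'.
have mur : measurable_fun A ur.
  apply: measurable_funTS; apply/(measurable_restrict _ mA' measurableT).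
  by rewrite setTI; exact: measurable_funTS.
have urM p : `|ur p| <= `|k| * C.
  rewrite /ur patchE; case: ifPn => // _; rewrite normr0 mulr_ge0//.
exists ur, (cst 0); split.
  split=> //.
  have : (@lebST R).-integrable A (EFin \o (fun p => ur p ^+ 2 + cst 0 p ^+ 2)).
    apply: (integrable_bounded_lty (C := (`|k| * C) ^+ 2)) => //.
      by apply: measurable_funD => //; exact: measurable_funX.
    move=> p _ /=; rewrite expr0n addr0 normrX lerXn2r ?nnegrE// ?mulr_ge0//.
  move=> /integrableP[_]; apply: le_lt_trans; apply: ge0_le_integral => //.
  - by move=> p _; rewrite lee_fin addr_ge0 ?sqr_ge0.
  - by apply/measurable_EFinP; apply: measurable_funD => //; exact: measurable_funX.
  - apply: measurableT_comp => //; apply/measurable_EFinP.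
    by apply: measurable_funD => //; exact: measurable_funX.
  - by move=> p _ /=; rewrite lee_fin ler_norm.
have key (h : R -> R) (tau : R) : continuous h -> (forall s, `|h s| <= 1) ->
    \int[@lebST R]_(p in A) (h (phase x tau p) * ur p) =
    k * \int[@lebST R]_(p in ball3 y eps `*` `]tmin, eta[) h (phase x tau p).
  move=> ch h1.
  have mh := continuous_measurable_fun ch.
  have mphase : measurable_fun setT (phase x tau).
    by apply: measurable_funM => //; exact: measurable_travel_time.
  have mhp : measurable_fun setT (fun p => h (phase x tau p)).
    exact: (measurableT_comp mh mphase).
  have mwp : measurable_fun setT (fun p : pt R * R => w (dist3 x p.1)).
    exact: (measurableT_comp mw mrho1).
  have mhw : measurable_fun setT (fun p => h (phase x tau p) * w (dist3 x p.1)).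
    exact: measurable_funM.
  have hwC p : `|h (phase x tau p) * w (dist3 x p.1)| <= C.
    by rewrite normrM -[leRHS]mul1r ler_pM// ger0_norm.
  rewrite Rintegral_mul_restrict//.
  transitivity (k * \int[@lebST R]_(p in A') (h (phase x tau p) * w (dist3 x p.1))).
    rewrite -RintegralZl//; first by apply: eq_Rintegral => p _; rewrite /g; ring.
    apply: (integrable_bounded_lty (C := C)) => //.
    exact: measurable_funTS.
  congr (k * fine _).
  (* Once [t] is fixed, the phase depends on space only through the distance to [x], which is the
     form of integrand that [Hw] transfers. *)
  rewrite (Rintegral_lebST_X tmin eta mD Dlty mhw hwC).
  rewrite (Rintegral_lebST_X tmin eta mB Blty mhp (fun p => h1 _)).
  apply: eq_integral => t _; rewrite /phase/=.
  have mht : measurable_fun setT (fun r => h (tau * (t + r))).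
    apply: (measurableT_comp mh); apply: measurable_funM => //.
    exact: measurable_funD.
  by rewrite (Hw _ _ mht (fun r => h1 _)).
apply: aeW => tau _; split.
- rewrite /LD_re /phi_re RintLE (@RintLE _ _ _ (@lebST R)) -/k -(key cos tau).
  + by apply: eq_Rintegral => p _; rewrite /= mulr0 subr0.
  + exact: continuous_cos.
  + by move=> s; rewrite ler_norml cos_geN1 cos_le1.
- rewrite /LD_im /phi_im RintLE (@RintLE _ _ _ (@lebST R)) -/k -(key sin tau).
  + by apply: eq_Rintegral => p _; rewrite /= mulr0 addr0.
  + exact: continuous_sin.
  + by move=> s; rewrite ler_norml sin_geN1 sin_le1.
Qed.

End range_membership.

Theorem mainTheorem9 (R : realType) (D : set (pt R)) (Rad tmin tmax kmin kmax : R)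
  (x : pt R) :
  bounded_lipschitz_domain D ->
  connected (~` closure D) ->
  D `<=` ball3 (pt0 R) Rad ->
  0 <= tmin -> tmin < tmax ->
  0 <= kmin -> kmin < kmax ->
  dist3 (pt0 R) x = Rad ->
  let K := (kmax - kmin) / 2 in
  (forall y : pt R, annulus_D D x y ->
     exists eps0 : R, 0 < eps0 /\
       forall eps eta : R, 0 < eps < eps0 -> tmin < eta <= tmax ->
         in_range_LD D tmin tmax x K
           (phi_re tmin x y eta eps) (phi_im tmin x y eta eps)) /\
  (forall eta : R, tmin < eta <= tmax ->
     forall y : pt R, ~ closure (annulus_D_eta D tmax eta x) y ->
       forall eps : R, 0 < eps ->
         ~ in_range_LD D tmin tmax x K
             (phi_re tmin x y eta eps) (phi_im tmin x y eta eps)).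
Proof.
move=> [oD cD D0 bD _] _ _ tmin0 _ _ kk _ K.
have K0 : 0 < K by rewrite divr_gt0// subr_gt0.
split=> [y yann|eta tet y ny eps e0]; last exact: not_in_range_outside_annulus.
(* Both [eps0] and [C] come from a comparison in space alone, so they serve every [eta]. *)
have [eps0 [eps00 [C C0 cmp]]] := shell_comparison oD cD D0 bD yann.
exists eps0; split=> // eps eta /andP[_ epsl] tet.
exact: (in_range_LD_ball K oD bD tet C0 (cmp eps epsl)).
Qed.
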